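(* Let $T$ be a complete NATP theory and $\mathbb{M}$ its monster model. Suppose that for any model $N$ and any tuple $c\in\mathbb{M}$, there exists an invariant Morley sequence which is a witness of Kim-dividing of $c$ over $N$. Let $M$ be a model, $a\in\mathbb{M}$ a tuple, and $I=(a_i)_{i<\omega}$ a coheir Morley sequence over $M$ with $a_0=a$. If $I$ is a witness of Kim-dividing of $a$ over $M$, then $I$ is a strict coheir Morley sequence of $\mathrm{tp}(a/M)$.
   Context: $T$ is a complete first-order $\mathcal{L}$-theory with monster model $\mathbb{M}$; tuples and small sets live in $\mathbb{M}$ and models $M,N$ are small elementary submodels of $\mathbb{M}$. A global type is a complete type over $\mathbb{M}$. Formulas $\varphi(x,y)$ may use parameters from the base. ATP/NATP: An $\mathcal{L}$-formula $\varphi(x,y)$ has the antichain tree property (ATP) if there is $(a_\eta)_{\eta\in 2^{<\omega}}$ such that $\{\varphi(x,a_\eta)\}_{\eta\in X}$ is consistent for every antichain $X\subseteq 2^{<\omega}$ (a set of pairwise $\subseteq$-incomparable strings), and $\{\varphi(x,a_\eta),\varphi(x,a_\nu)\}$ is inconsistent whenever $\eta\subsetneq\nu$. $T$ is NATP if no formula has ATP. A global type $p(x)$ is invariant over $M$ if $\varphi(x,b)\in p\Leftrightarrow\varphi(x,b')\in p$ whenever $b\equiv_M b'$. A type is a coheir over $M$ if it is finitely satisfiable in $M$. A sequence $(a_i)_{i<\omega}$ is generated by a global type $p$ over $M$ if $a_i\models p|_{Ma_{<i}}$ for all $i$; it is an invariant (respectively coheir) Morley sequence over $M$, in $\mathrm{tp}(a/M)$,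 if it is generated over $M$ by a global type $p\supseteq \mathrm{tp}(a/M)$ which is invariant over $M$ (respectively a coheir over $M$). $\varphi(x,a)$ Kim-divides over $M$ if there is an invariant Morley sequence $(a_i)_{i<\omega}$ in $\mathrm{tp}(a/M)$ such that $\{\varphi(x,a_i)\}_{i<\omega}$ is inconsistent. A type Kim-forks over $M$ if it implies a finite disjunction of formulas with parameters, each of which Kim-divides over $M$. An $M$-indiscernible sequence $(b_i)_{i<\omega}$ is a witness of Kim-dividing of $b$ over $M$ if $b_0=b$ and $\{\varphi(x,b_i)\}_{i<\omega}$ is inconsistent whenever $\varphi(x,b)$ Kim-divides over $M$. A global type $p(x)$ is a strict coheir (with respect to Kim-forking) over $M$ if for every small set $C$ and every $a'\models p|_{MC}$, the type $\mathrm{tp}(a'/MC)$ is a coheir over $M$ and $\mathrm{tp}(C/Ma')$ does not Kim-fork over $M$. A strict coheir Morley sequence of $\mathrm{tp}(a/M)$ is a sequence generated over $M$ by a strict coheir over $M$ containing $\mathrm{tp}(a/M)$. *)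

(* Defs.v *)
From mathcomp Require Import all_boot.
From mathcomp Require Import boolp classical_sets functions cardinality.

Set Implicit Arguments.
Unset Strict Implicit.
Unset Printing Implicit Defensive.

Local Open Scope classical_set_scope.

Record language := Language {
  fun_symb : Type;
  fun_ar : fun_symb -> nat;
  rel_symb : Type;
  rel_ar : rel_symb -> nat }.

(** Well-scoped syntax: [formula L V] is the type of first-order formulas (with
    equality) whose free variables are among [V]; the body of a quantifier has
    the extra variable [None].  [V] may be infinite, which gives formulas in an
    infinite tuple of variables, each mentioning finitely many of them. *)
Inductive term (L : language) (V : Type) : Type :=
| tVar of V
| tFun (f : fun_symb L) of ('I_(fun_ar f) -> term L V).

Inductive formula (L : language) (V : Type) : Type :=
| fFalse
| fEq of term L V & term L V
| fRel (R : rel_symb L) of ('I_(rel_ar R) -> term L V)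
| fImp of formula L V & formula L V
| fAll of formula L (option V).

Arguments tVar {L V} _.
Arguments tFun {L V} f _.
Arguments fFalse {L V}.
Arguments fEq {L V} _ _.
Arguments fRel {L V} R _.
Arguments fImp {L V} _ _.
Arguments fAll {L V} _.

Definition fNot L V (phi : formula L V) := fImp phi fFalse.
Definition fOr L V (phi psi : formula L V) := fImp (fNot phi) psi.

Fixpoint term_rename L V W (h : V -> W) (t : term L V) : term L W :=
  match t with
  | tVar v => tVar (h v)
  | tFun f ts => tFun f (fun i => term_rename h (ts i))
  end.

Fixpoint rename L V W (h : V -> W) (phi : formula L V) : formula L W :=
  match phi with
  | fFalse => fFalse
  | fEq t1 t2 => fEq (term_rename h t1) (term_rename h t2)
  | fRel R ts => fRel R (fun i => term_rename h (ts i))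
  | fImp psi chi => fImp (rename h psi) (rename h chi)
  | fAll psi => fAll (rename (omap h) psi)
  end.

Fixpoint term_occurs L V (v : V) (t : term L V) : Prop :=
  match t with
  | tVar w => v = w
  | tFun f ts => exists i, term_occurs v (ts i)
  end.

Fixpoint occurs L V (v : V) (phi : formula L V) : Prop :=
  match phi with
  | fFalse => False
  | fEq t1 t2 => term_occurs v t1 \/ term_occurs v t2
  | fRel R ts => exists i, term_occurs v (ts i)
  | fImp psi chi => occurs v psi \/ occurs v chi
  | fAll psi => occurs (Some v) psi
  end.

Record structure (L : language) := Structure {
  carrier :> Type;
  carrier_ne : inhabited carrier;
  fun_int : forall f : fun_symb L, ('I_(fun_ar f) -> carrier) -> carrier;
  rel_int : forall R : rel_symb L, ('I_(rel_ar R) -> carrier) -> Prop }.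

Arguments fun_int {L} _ f _.
Arguments rel_int {L} _ R _.

Fixpoint eval L (A : structure L) V (e : V -> A) (t : term L V) : A :=
  match t with
  | tVar v => e v
  | tFun f ts => fun_int A f (fun i => eval e (ts i))
  end.

Fixpoint sat L (A : structure L) V (e : V -> A) (phi : formula L V) : Prop :=
  match phi with
  | fFalse => False
  | fEq t1 t2 => eval e t1 = eval e t2
  | fRel R ts => rel_int A R (fun i => eval e (ts i))
  | fImp psi chi => sat e psi -> sat e chi
  | fAll psi => forall u : A, sat (fun o : option _ => oapp e u o) psi
  end.

Definition models L (A : structure L) (T : set (formula L void)) :=
  forall sigma, T sigma -> sat (of_void A) sigma.

Definition entails L (T : set (formula L void)) (sigma : formula L void) :=
  forall A : structure L, models A T -> sat (of_void A) sigma.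

Definition complete_theory L (T : set (formula L void)) :=
  (exists A : structure L, models A T) /\
  (forall sigma, entails T sigma \/ entails T (fNot sigma)).

Definition fun_closed L (A : structure L) (D : set A) :=
  forall (f : fun_symb L) (args : 'I_(fun_ar f) -> A),
    (forall i, D (args i)) -> D (fun_int A f args).

Definition substructure L (A : structure L) (D : set A)
    (D_ne : inhabited {x : A | D x}) (D_cl : fun_closed D) : structure L :=
  @Structure L {x : A | D x} D_ne
    (fun f args => exist D (fun_int A f (fun i => sval (args i)))
                         (D_cl f _ (fun i => svalP (args i))))
    (fun R args => rel_int A R (fun i => sval (args i))).

Definition elementary_submodel L (A : structure L) (D : set A) :=
  exists (D_ne : inhabited {x : A | D x}) (D_cl : fun_closed D),
    forall (n : nat) (phi : formula L 'I_n) (e : 'I_n -> {x : A | D x}),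
      @sat L (substructure D_ne D_cl) _ e phi <-> sat (fun i => sval (e i)) phi.

Definition automorphism L (A : structure L) (h : A -> A) :=
  [/\ bijective h,
      forall (f : fun_symb L) args,
        h (fun_int A f args) = fun_int A f (fun i => h (args i)) &
      forall (R : rel_symb L) args,
        rel_int A R args <-> rel_int A R (fun i => h (args i))].

(** An [X]-tuple of [U] is a function [X -> U].  A formula in the tuple of
    variables [x = (x_i)_{i in X}] with parameters in [U] is an element of
    [formula L (X + U)]: [inl i] is the variable [x_i], [inr u] the parameter
    [u], and [env a] evaluates it at [x := a]. *)

Definition env X (U : Type) (a : X -> U) (v : X + U) : U :=
  match v with inl i => a i | inr u => u end.

Definition fml_over L (U : structure L) X (A : set U)
    (phi : formula L (X + U)) :=
  forall u, occurs (inr u) phi -> A u.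

(** A formula [phi(x,y)] with parameters in [U], where [x] is an [X]-tuple and
    [y] a [Y]-tuple of variables, is an element of [formula L (X + (Y + U))];
    [inst phi b] is [phi(x,b)]. *)
Definition fml2_over L (U : structure L) X Y (A : set U)
    (phi : formula L (X + (Y + U))) :=
  forall u, occurs (inr (inr u)) phi -> A u.

Definition plug X Y W (b : Y -> W) (v : X + Y) : X + W :=
  match v with inl i => inl i | inr j => inr (b j) end.

Definition inst L (U : structure L) X Y (phi : formula L (X + (Y + U)))
    (b : Y -> U) : formula L (X + U) :=
  rename (plug (env b)) phi.

Definition realizes L (U : structure L) X (a : X -> U)
    (S : set (formula L (X + U))) :=
  forall phi, S phi -> sat (env a) phi.

(** Consistency with the elementary diagram of [U] (by compactness). *)
Definition consistent L (U : structure L) X (S : set (formula L (X + U))) :=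
  forall F, finite_set F -> F `<=` S -> exists a : X -> U, realizes a F.

Definition implies_fml L (U : structure L) X (S : set (formula L (X + U)))
    (phi : formula L (X + U)) :=
  ~ consistent (S `|` [set fNot phi]).

Definition tp L (U : structure L) X (a : X -> U) (A : set U) :
    set (formula L (X + U)) :=
  [set phi | fml_over A phi /\ sat (env a) phi].

Definition restr L (U : structure L) X (p : set (formula L (X + U)))
    (A : set U) : set (formula L (X + U)) :=
  [set phi | p phi /\ fml_over A phi].

(** The monster is kappa-saturated and strongly kappa-homogeneous for some
    kappa > |L| + aleph_0, and small means of cardinality < kappa.  Cardinals
    are given by types: kappa is the cardinality of [K]. *)

Definition card_lt S T (A : set S) (B : set T) : Prop :=
  (A #<= B)%card /\ ~ (B #<= A)%card.

Definition small (K : Type) S (A : set S) := card_lt A [set: K].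

Definition saturated L (K : Type) (U : structure L) :=
  forall (A : set U) (S : set (formula L ('I_1 + U))), small K A ->
    (forall phi, S phi -> fml_over A phi) -> consistent S ->
    exists a, realizes a S.

Definition strongly_homogeneous L (K : Type) (U : structure L) :=
  forall (X : Type) (a b : X -> U), small K [set: X] ->
    tp a set0 = tp b set0 ->
    exists2 h, automorphism h & forall i, h (a i) = b i.

Definition monster L (T : set (formula L void)) (K : Type) (U : structure L) :=
  [/\ models U T,
      [/\ small K [set: nat], small K [set: fun_symb L] &
          small K [set: rel_symb L]],
      saturated K U &
      strongly_homogeneous K U].

Definition small_model L (K : Type) (U : structure L) (M : set U) :=
  small K M /\ elementary_submodel M.

Definition antichain (A : set (seq bool)) :=
  forall eta nu, A eta -> A nu -> eta <> nu -> ~~ prefix eta nu.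

(** [rename (plug inl) phi] is the L-formula [phi(x,y)] seen as a formula with
    (no) parameters. *)
Definition has_ATP L (U : structure L) n m (phi : formula L ('I_n + 'I_m)) :=
  let phi' : formula L ('I_n + ('I_m + U)) := rename (plug inl) phi in
  exists a : seq bool -> 'I_m -> U,
    (forall A, antichain A -> consistent [set inst phi' (a eta) | eta in A]) /\
    (forall eta nu, prefix eta nu -> eta <> nu ->
       ~ consistent [set inst phi' (a eta); inst phi' (a nu)]).

Definition NATP L (U : structure L) :=
  forall n m (phi : formula L ('I_n + 'I_m)), ~ has_ATP U phi.

Definition global_type L (U : structure L) X (p : set (formula L (X + U))) :=
  consistent p /\ forall phi, p phi \/ p (fNot phi).

Definition invariant_over L (U : structure L) X (M : set U)
    (p : set (formula L (X + U))) :=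
  forall n (phi : formula L (X + ('I_n + U))) (b b' : 'I_n -> U),
    fml2_over M phi -> tp b M = tp b' M -> (p (inst phi b) <-> p (inst phi b')).

Definition coheir_over L (U : structure L) X (M : set U)
    (p : set (formula L (X + U))) :=
  forall F, finite_set F -> F `<=` p ->
    exists2 a : X -> U, (forall i, M (a i)) & realizes a F.

Definition generated L (U : structure L) X (M : set U)
    (p : set (formula L (X + U))) (a : nat -> X -> U) :=
  forall i, realizes (a i)
    (restr p (M `|` [set u | exists2 j, (j < i)%N & range (a j) u])).

(** [s] is generated over [M] by a global type extending tp(a/M) which has the
    property [P]. *)
Definition morley L (U : structure L) X (P : set (set (formula L (X + U))))
    (M : set U) (a : X -> U) (s : nat -> X -> U) :=
  exists p, [/\ global_type p, tp a M `<=` p, P p & generated M p s].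

Definition invariant_morley L (U : structure L) X (M : set U) :=
  morley (@invariant_over L U X M) M.

Definition coheir_morley L (U : structure L) X (M : set U) :=
  morley (@coheir_over L U X M) M.

Definition kim_divides L (U : structure L) X Y (M : set U)
    (phi : formula L (X + (Y + U))) (a : Y -> U) :=
  fml2_over M phi /\
  exists2 s : nat -> Y -> U,
    invariant_morley M a s & ~ consistent [set inst phi (s i) | i in setT].

(** [kim_divides] for a formula with parameters in [U] given without a splitting
    of its parameters into the tuple [a] and the part over [M]. *)
Definition kim_divides_fml L (U : structure L) X (M : set U)
    (psi : formula L (X + U)) :=
  exists m (phi : formula L (X + ('I_m + U))) (a : 'I_m -> U),
    psi = inst phi a /\ kim_divides M phi a.

Definition kim_forks L (U : structure L) X (M : set U)
    (p : set (formula L (X + U))) :=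
  exists n (psi : 'I_n -> formula L (X + U)),
    (forall i, kim_divides_fml M (psi i)) /\
    implies_fml p (\big[@fOr L (X + U)/fFalse]_(i < n) psi i).

Definition indiscernible L (U : structure L) Y (M : set U)
    (s : nat -> Y -> U) :=
  forall k (f g : 'I_k -> nat),
    {homo f : i j / (i < j)%N} -> {homo g : i j / (i < j)%N} ->
    tp (fun v : 'I_k * Y => s (f v.1) v.2) M =
    tp (fun v : 'I_k * Y => s (g v.1) v.2) M.

Definition kim_witness L (U : structure L) Y (M : set U) (b : Y -> U)
    (s : nat -> Y -> U) :=
  [/\ indiscernible M s,
      s 0 = b &
      forall n (phi : formula L ('I_n + (Y + U))), kim_divides M phi b ->
        ~ consistent [set inst phi (s i) | i in setT]].

Definition enum_set U (C : set U) : {u | C u} -> U := sval.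

Definition strict_coheir L (K : Type) (U : structure L) X (M : set U)
    (p : set (formula L (X + U))) :=
  forall (C : set U) (a' : X -> U), small K C ->
    realizes a' (restr p (M `|` C)) ->
    coheir_over M (tp a' (M `|` C)) /\
    ~ kim_forks M (tp (@enum_set U C) (M `|` range a')).

Definition strict_coheir_morley L (K : Type) (U : structure L) X (M : set U) :=
  morley (@strict_coheir L K U X M) M.

(* Main.v *)
Require Import Defs.
From mathcomp Require Import all_boot.
From mathcomp Require Import boolp classical_sets functions cardinality.
From mathcomp Require Import filter.
From Stdlib Require List.

(** The proof has two halves.

    The first half shows that in an NATP theory Kim-dividing over a model [M]
    is witnessed by coheirs ([coheir_kim_divides]).  Let [p] be a global type
    invariant over [M] such that [phi(x, -)] is inconsistent along the Morley
    sequences of [p].  Call a set of tuples of [M] tiny if it cannot meet some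
    coheir [S] along the type of a realization of [p] above a realization of
    [S].  Tiny sets form a proper ideal, by tensoring the coheirs that witness
    two of them, so some ultrafilter [Q] on the tuples of [M] avoids them all
    ([generic_ex]).  This [Q] is a coheir of [p|M], and it can be carried by
    the root of a tree whose upper part already carries a coheir, where the
    root realizes [p] over that part.  Iterating, one gets trees of height [n]
    in which each node realizes [p] over what lies above it, while every
    antichain is a Morley sequence of [Q] ([tree_ex] builds them together with
    the sequences [V] below).

    Suppose now that [phi] is consistent along the Morley sequences of [Q].
    Consider brooms: [j] realizations of [p], each over the previous ones and
    over a Morley sequence of [Q].  Brooms with [j = 0] are consistent for
    [phi], long ones are not, so for some [j] all brooms with [j] handles are
    consistent, but those with [j + 1] handles and [t] bristles are not.  Put
    [j] handles below the whole tree, and let each node carry a root [w] and,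
    beside the subtree above [w], a Morley sequence [V] of [Q] of length [t].
    Over an antichain one sees a broom with [j] handles, which is consistent;
    over two comparable nodes one sees the lower [w] below the upper [V],
    hence [j + 1] handles and [t] bristles, which is inconsistent.  This is an
    instance of ATP.

    The second half first deduces that a formula which Kim-forks over [M]
    Kim-divides over [M] ([kim_forks_divides]).  If [psi(y, a)] implies the
    disjunction of the Kim-dividing formulas [psi_j(y, b_j)], take a witness
    for the whole tuple [(a, b_0, ..., b_N)].  Each [psi_j] Kim-divides with
    respect to the whole tuple, because a coheir of [tp(b_j/M)] extends to a
    coheir of the type of a larger tuple, which may fail for invariant types;
    so the witness makes every [psi_j], and by the pigeonhole principle their
    disjunction, inconsistent.

    Let finally [I] be generated by the coheir [p] and be a witness for [a].
    The restriction of [p] to [M] and [I], together with all the formulas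
    [~ psi(c, x)] where [psi(y, a)] Kim-divides over [M], is finitely
    satisfiable in [M]: otherwise [p] contains some [psi(c, x)], and then the
    entries of [I] can be replaced by tuples of [M] that satisfy [psi(c, x)],
    so that [c] realizes instances of [psi] that are inconsistent
    ([coheir_consistent]).  An ultrafilter on the tuples of [M] that contains
    this partial type is the strict coheir that generates [I]. *)

Set Implicit Arguments.
Unset Strict Implicit.
Unset Printing Implicit Defensive.

Local Open Scope classical_set_scope.

(** * Formulas and renamings of variables *)

Section Syntax.
Variable L : language.

Lemma eval_rename (A : structure L) V W (h : V -> W) (e : W -> A) t :
  eval e (term_rename h t) = eval (e \o h) t.
Proof.
elim: t => //= f ts IH; congr (fun_int A f _).
by apply/funext => i; exact: IH.
Qed.

Lemma sat_rename (A : structure L) V W (h : V -> W) (e : W -> A) phi :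
  sat e (rename h phi) <-> sat (e \o h) phi.
Proof.
elim: phi W h e => [V'|V' t1 t2|V' R ts|V' p1 IH1 p2 IH2|V' p IH] W h e //=.
- by rewrite !eval_rename.
- suff -> : (fun i => eval e (term_rename h (ts i))) =
            (fun i => eval (e \o h) (ts i)) by [].
  by apply/funext => i; rewrite eval_rename.
- by split=> H /(IH1 _ h)/H /(IH2 _ h).
- split=> H u; have := H u; rewrite IH;
    by congr (sat _ p); apply/funext => -[].
Qed.

Lemma eval_occurs (A : structure L) V (e e' : V -> A) t :
  (forall v, term_occurs v t -> e v = e' v) -> eval e t = eval e' t.
Proof.
elim: t => [v|f ts IH] H /=; first exact: H.
congr (fun_int A f _); apply/funext => i; apply: IH => v vi.
by apply: H; exists i.
Qed.

Lemma sat_occurs (A : structure L) V (e e' : V -> A) phi :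
  (forall v, occurs v phi -> e v = e' v) -> sat e phi <-> sat e' phi.
Proof.
elim: phi e e' => [V'|V' t1 t2|V' R ts|V' p1 IH1 p2 IH2|V' p IH] e e' H //=.
- rewrite (@eval_occurs A V' e e' t1) ?(@eval_occurs A V' e e' t2) //.
  + by move=> v vt; apply: H; right.
  + by move=> v vt; apply: H; left.
- suff -> : (fun i => eval e (ts i)) = (fun i => eval e' (ts i)) by [].
  by apply/funext => i; apply: eval_occurs => v vi; apply: H; exists i.
- have E1 : sat e p1 <-> sat e' p1 by apply: IH1 => v vi; apply: H; left.
  have E2 : sat e p2 <-> sat e' p2 by apply: IH2 => v vi; apply: H; right.
  by rewrite E1 E2.
- have E u : sat (fun o => oapp e u o) p <-> sat (fun o => oapp e' u o) p.
    by apply: IH; case=> [v|] //= vi; exact: H.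
  by split=> Hs u; apply/E.
Qed.

Lemma term_occurs_rename V W (h : V -> W) (t : term L V) w :
  term_occurs w (term_rename h t) -> exists2 v, term_occurs v t & w = h v.
Proof.
elim: t => [v|f ts IH] /=; first by move=> ->; exists v.
by case=> i /IH[v vi ->]; exists v => //; exists i.
Qed.

Lemma occurs_rename V W (h : V -> W) (phi : formula L V) w :
  occurs w (rename h phi) -> exists2 v, occurs v phi & w = h v.
Proof.
elim: phi W h w => [V'|V' t1 t2|V' R ts|V' p1 IH1 p2 IH2|V' p IH] W h w //=.
- by case=> H; have [v vt ->] := term_occurs_rename H; exists v => //;
  [left|right].
- by case=> i H; have [v vt ->] := term_occurs_rename H; exists v => //;
  exists i.
- by case=> [/(IH1 _ h)|/(IH2 _ h)] [v vt ->]; exists v => //; [left|right].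
- by move=> /(IH _ (omap h))[[v|]] //= vp [->]; exists v.
Qed.

Lemma finite_term_occurs V (t : term L V) :
  finite_set [set v | term_occurs v t].
Proof.
elim: t => [v|f ts IH] /=; first exact: finite_set1.
have -> : [set v | exists i, term_occurs v (ts i)] =
    \bigcup_(i in [set: 'I_(fun_ar f)]) [set v | term_occurs v (ts i)].
  by apply/seteqP; split=> v [i]; [exists i|move=> _ /=; exists i].
by apply: bigcup_finite => // ; exact: finite_finset.
Qed.

Lemma finite_occurs V (phi : formula L V) : finite_set [set v | occurs v phi].
Proof.
elim: phi => [V'|V' t1 t2|V' R ts|V' p1 IH1 p2 IH2|V' p IH] /=.
- have -> : [set v : V' | False] = set0 by apply/seteqP; split.
  exact: finite_set0.
- have -> : [set v | term_occurs v t1 \/ term_occurs v t2] =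
    [set v | term_occurs v t1] `|` [set v | term_occurs v t2] by [].
  by rewrite finite_setU; split; exact: finite_term_occurs.
- have -> : [set v | exists i, term_occurs v (ts i)] =
      \bigcup_(i in [set: 'I_(rel_ar R)]) [set v | term_occurs v (ts i)].
    by apply/seteqP; split=> v [i]; [exists i|move=> _ /=; exists i].
  apply: bigcup_finite => [|i _]; first exact: finite_finset.
  exact: finite_term_occurs.
- have -> : [set v | occurs v p1 \/ occurs v p2] =
    [set v | occurs v p1] `|` [set v | occurs v p2] by [].
  by rewrite finite_setU.
- by apply: (@finite_preimage _ _ _ Some) IH => x y _ _ [].
Qed.



Lemma finite_enum T (A : set T) : finite_set A ->
  exists n (h : 'I_n -> T), [/\ injective h, forall i, A (h i) &
    forall a, A a -> exists i, a = h i].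
Proof.
elim/Peq: T A => T A /finite_seqP[s ->].
exists (size (undup s)), (tnth (in_tuple (undup s))); split=> [|i|a /=].
- by apply/tuple_uniqP; exact: undup_uniq.
- by rewrite /= -mem_undup; exact: mem_tnth.
- rewrite -mem_undup => /(nthP a)[i ilt <-].
  by exists (Ordinal ilt); rewrite (tnth_nth a).
Qed.

Lemma finite_list T (A : set T) : finite_set A ->
  exists s : seq T, forall a, A a <-> List.In a s.
Proof.
elim/Peq: T A => T A /finite_seqP[s ->]; exists s => a /=.
elim: s => //= b s IH; rewrite inE; split=> [/orP[/eqP ->|/IH H]|[->|/IH ->]].
- by left.
- by right.
- by rewrite eqxx.
- by rewrite orbT.
Qed.

Lemma sat_or (A : structure L) V (e : V -> A) phi psi :
  sat e (fOr phi psi) <-> sat e phi \/ sat e psi.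
Proof.
split=> [H|[H|H] //= /(_ H)[]].
by have [h|h] := pselect (sat e phi); [left|right; exact: H].
Qed.

Lemma sat_bigor V (A : structure L) (e : V -> A) n (psi : 'I_n -> formula L V) :
  sat e (\big[@fOr L V/fFalse]_(i < n) psi i) <-> exists i, sat e (psi i).
Proof.
elim: n psi => [|n IH] psi; first by rewrite big_ord0; split=> // -[[]].
rewrite big_ord_recl sat_or IH; split=> [[H|[i H]]|[i]].
- by exists ord0.
- by exists (lift ord0 i).
- by case: (unliftP ord0 i) => [j ->|->] H; [right; exists j|left].
Qed.

(** Existential quantification of the variable [w], which stays in the set of
    variables. *)
Definition fEx V (w : V) (phi : formula L V) : formula L V :=
  fNot (fAll (fNot (rename (fun v =>
    if `[< v = w >] then None else Some v) phi))).

Definition upd V A (e : V -> A) (w : V) (u : A) : V -> A :=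
  fun v => if `[< v = w >] then u else e v.

Lemma sat_ex (A : structure L) V (e : V -> A) w phi :
  sat e (fEx w phi) <-> exists u, sat (upd e w u) phi.
Proof.
have E u : sat (fun o => oapp e u o)
    (rename (fun v => if `[< v = w >] then None else Some v) phi) <->
    sat (upd e w u) phi.
  rewrite sat_rename; suff -> : (oapp e u \o
    (fun v => if `[< v = w >] then None else Some v)) = upd e w u by [].
  by apply/funext => v; rewrite /upd /=; case: asboolP.
split=> [H|[u /E Hu] H]; last exact: (H u).
by apply: contrapT => N; apply: H => u /E Hu; apply: N; exists u.
Qed.

Lemma occurs_ex V (w : V) (phi : formula L V) v :
  occurs v (fEx w phi) -> occurs v phi /\ v <> w.
Proof.
case=> // -[H|//]; have [v' v'p] := occurs_rename H.
by case: asboolP => // ne [->].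
Qed.

Fixpoint fExs V (s : seq V) (phi : formula L V) : formula L V :=
  if s is w :: s' then fEx w (fExs s' phi) else phi.

Lemma occurs_exs V (s : seq V) (phi : formula L V) v :
  occurs v (fExs s phi) -> occurs v phi /\ ~ List.In v s.
Proof.
elim: s => [|w s IH] /=; first by split.
by move=> H; have [/IH[vp vs] vw] := occurs_ex H; split=> // -[/esym|].
Qed.

Lemma sat_exs (A : structure L) V (e : V -> A) s phi :
  sat e (fExs s phi) <->
  exists2 e', (forall v, ~ List.In v s -> e' v = e v) & sat e' phi.
Proof.
elim: s e => [|w s IH] e.
  split=> [H|[e' E]]; first by exists e.
  by rewrite (_ : e' = e) //; apply/funext => v; apply: E.
rewrite [fExs _ _]/= sat_ex; split=> [[u /IH[e' E H]]|[e' E H]].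
  exists e' => // v nv; rewrite E ?/upd; last by move=> vs; apply: nv; right.
  by case: asboolP => // vw; case: nv; left.
exists (e' w); apply/IH; exists e' => // v nv; rewrite /upd.
by case: asboolP => [-> //|vw]; apply: E => -[/esym|].
Qed.

End Syntax.

(** * Definable predicates *)

Definition jn X Z (U : Type) (x : X -> U) (z : Z -> U) (v : X + Z) : U :=
  match v with inl i => x i | inr j => z j end.

Section Definable.
Variables (L : language) (U : structure L).
Implicit Types (A B M : set U).

(** Working with the predicates that formulas define, rather than with the
    formulas, makes renamings of variables invisible. *)
Definition dfn B Z (P : (Z -> U) -> Prop) :=
  exists theta : formula L (Z + U),
    fml_over B theta /\ forall e, P e <-> sat (env e) theta.

Lemma dfn_ext B Z (P Q : (Z -> U) -> Prop) :
  (forall e, P e <-> Q e) -> dfn B P -> dfn B Q.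
Proof. by move=> E [t [tB tP]]; exists t; split=> // e; rewrite -E. Qed.

Lemma dfn_sub A B Z (P : (Z -> U) -> Prop) : A `<=` B -> dfn A P -> dfn B P.
Proof. by move=> AB [t [tB tP]]; exists t; split=> // u /tB/AB. Qed.

Lemma dfn_sat B Z (theta : formula L (Z + U)) :
  fml_over B theta -> dfn B (fun e => sat (env e) theta).
Proof. by exists theta. Qed.

Lemma dfn_false B Z : dfn B (fun _ : Z -> U => False).
Proof. by exists (@fFalse L (Z + U)%type); split. Qed.

Lemma dfn_imp B Z (P Q : (Z -> U) -> Prop) :
  dfn B P -> dfn B Q -> dfn B (fun e => P e -> Q e).
Proof.
move=> [t [tB tP]] [t' [tB' tP']]; exists (fImp t t'); split.
  by move=> u; case=> [/tB|/tB'].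
by move=> e /=; rewrite tP tP'.
Qed.

Lemma dfn_not B Z (P : (Z -> U) -> Prop) : dfn B P -> dfn B (fun e => ~ P e).
Proof. by move=> dP; apply: dfn_imp => //; exact: dfn_false. Qed.

Lemma dfn_and B Z (P Q : (Z -> U) -> Prop) :
  dfn B P -> dfn B Q -> dfn B (fun e => P e /\ Q e).
Proof.
move=> dP dQ.
apply: (dfn_ext _ (dfn_not (dfn_imp dP (dfn_not dQ)))) => e.
split=> [H|[p q] /(_ p q)//].
by split; apply: contrapT => N; apply: H => p q; apply: N.
Qed.

Lemma dfn_true B Z : dfn B (fun _ : Z -> U => True).
Proof.
have H := dfn_not (@dfn_false B Z).
by apply: dfn_ext H => e; split=> // _ [].
Qed.

Lemma dfn_forall_seq B Z I (s : seq I) (P : I -> (Z -> U) -> Prop) :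
  (forall i, List.In i s -> dfn B (P i)) ->
  dfn B (fun e => forall i, List.In i s -> P i e).
Proof.
elim: s => [|i s IH] dP; first by apply: dfn_ext (@dfn_true B Z) => e;
  split=> // _ j [].
have dPi : dfn B (P i) by apply: dP; left.
have {}IH := IH (fun j js => dP j (or_intror js)).
apply: dfn_ext (dfn_and dPi IH) => e /=; split.
  by case=> H1 H2 j [<-//|/H2].
by move=> H; split=> [|j js]; apply: H; [left|right].
Qed.

Lemma dfn_subst B Z Z' (g : Z -> Z' + U) (P : (Z -> U) -> Prop) :
  (forall z u, g z = inr u -> B u) -> dfn B P ->
  dfn B (fun e : Z' -> U => P (fun z => env e (g z))).
Proof.
move=> gB [t [tB tP]].
exists (rename (fun v => match v with inl z => g z | inr u => inr u end) t).
split=> [u H|e].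
  have [[z|u'] vt E] := occurs_rename H; first exact: gB (esym E).
  by case: E vt => -> /tB.
rewrite tP sat_rename.
suff -> : env e \o (fun v => match v with inl z => g z | inr u => inr u end) =
  env (fun z => env e (g z)) by [].
by apply/funext => -[].
Qed.

Lemma dfn_comp B Z Z' (g : Z -> Z') (P : (Z -> U) -> Prop) :
  dfn B P -> dfn B (fun e : Z' -> U => P (e \o g)).
Proof. by move=> dP; apply: (@dfn_subst B Z Z' (inl \o g) P). Qed.

(** Only the entries of [x] that occur in the formula are quantified, so [x] may
    be an infinite tuple. *)
Lemma dfn_ex B W Z (P : (W + Z -> U) -> Prop) :
  dfn B P -> dfn B (fun e : Z -> U => exists x : W -> U, P (jn x e)).
Proof.
have [u0] := carrier_ne U.
move=> [t [tB tP]].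
(* after quantification no variable of [W] occurs, and [r] may send them all to
   the arbitrary element [u0] *)
pose isW (v : (W + Z) + U) := if v is inl (inl _) then true else false.
have /finite_list[s sP] : finite_set [set v | occurs v t /\ isW v].
  by apply: sub_finite_set (finite_occurs t) => v [].
pose r (v : (W + Z) + U) : Z + U :=
  match v with inl (inl w) => inr u0 | inl (inr z) => inl z | inr u =>
    inr u end.
exists (rename r (fExs s t)); split=> [u H|e].
  have [v vt E] := occurs_rename H.
  have [{}vt vs] := occurs_exs vt.
  case: v => [[w|z]|u'] in vt vs E * => //.
    by case: vs; apply/sP.
  by case: E vt => -> /tB.
rewrite sat_rename sat_exs; split=> [[x /tP Px]|[e' E H]].
  exists (fun v => if `[< List.In v s >] then env (jn x e) v else (env e \o r) v).
    by move=> v vs; case: asboolP.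
  apply: (iffLR (sat_occurs _) Px) => v vt.
  case: asboolP => // vs.
  by case: v vt vs => [[w|z]|u] //= vt; case; apply/sP.
exists (fun w => e' (inl (inl w))); apply/tP.
apply: (iffLR (sat_occurs _) H) => v vt.
by case: v vt => [[w|z]|u] //= vt; rewrite E // => /sP[].
Qed.

Lemma dfn_all B W Z (P : (W + Z -> U) -> Prop) :
  dfn B P -> dfn B (fun e : Z -> U => forall x : W -> U, P (jn x e)).
Proof.
move=> /dfn_not/dfn_ex/dfn_not; apply: dfn_ext => e.
split=> [H x|H [x]]; last by apply.
by apply: contrapT => N; apply: H; exists x.
Qed.

Lemma dfn_fix A B W Z (P : (W + Z -> U) -> Prop) z :
  A `<=` B -> (forall i, B (z i)) -> dfn A P -> dfn B (fun x => P (jn x z)).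
Proof.
move=> AB zB dP.
pose g (v : W + Z) : W + U := match v with inl w => inl w | inr i =>
  inr (z i) end.
have gE e : (fun v => env e (g v)) = jn e z by apply/funext => -[].
apply: (@dfn_ext _ _ (fun e => P (fun v => env e (g v)))).
  by move=> e; rewrite gE.
by apply: dfn_subst (dfn_sub AB dP) => -[w|i] u //= [<-].
Qed.

Lemma dfn_fixl A B Z W (P : (Z + W -> U) -> Prop) z :
  A `<=` B -> (forall i, B (z i)) -> dfn A P -> dfn B (fun x => P (jn z x)).
Proof.
move=> AB zB dP.
pose sw (v : Z + W) : W + Z := match v with inl i => inr i | inr w => inl w end.
apply: (@dfn_ext _ _ (fun x => P (jn x z \o sw))).
  by move=> x; rewrite (_ : jn x z \o sw = jn z x) //; apply/funext => -[].
exact: (dfn_fix (P := fun e => P (e \o sw)) AB zB (dfn_comp sw dP)).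
Qed.

Lemma tp_dfn A Z (a b : Z -> U) :
  tp a A = tp b A <-> forall P, dfn A P -> P a -> P b.
Proof.
split=> [E P [t [tA tP]] /tP Pa|H].
  have : tp a A t by [].
  by rewrite E => -[_ /tP].
apply/seteqP; split=> t [tA ta]; split=> //.
  exact: (H _ (dfn_sat tA)).
apply: contrapT => Na.
exact: (H _ (dfn_not (dfn_sat tA))) ta.
Qed.

Lemma tp_iff A Z (a b : Z -> U) P : tp a A = tp b A -> dfn A P -> P a <-> P b.
Proof. 
by move=> E dP; split; [exact: (iffLR (tp_dfn A a b) E)|
                        exact: (iffLR (tp_dfn A b a) (esym E))].
 Qed.

Lemma tp_comp A Z Z' (g : Z' -> Z) (a b : Z -> U) :
  tp a A = tp b A -> tp (a \o g) A = tp (b \o g) A.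
Proof.
move=> E; apply/tp_dfn => P dP Pa.
exact: (iffLR (tp_iff E (dfn_comp g dP)) Pa).
Qed.

Lemma dfn_fin B X Z (P : (X + Z -> U) -> Prop) : dfn B P ->
  exists n (h : 'I_n -> Z) (P' : (X + 'I_n -> U) -> Prop),
    [/\ injective h, dfn B P' & forall x z, P (jn x z) <-> P' (jn x (z \o h))].
Proof.
have [u0] := carrier_ne U; move=> [t [tB tP]].
have /finite_enum[n [h [hI _ hP]]] : finite_set [set z | occurs (inl (inr z)) t].
  apply: (@finite_preimage _ _ _ (fun z => inl (inr z)) _ (finite_occurs t)).
  by move=> x y _ _ [].
have /choice[g gP] : forall z : Z, exists v : (X + 'I_n) + U,
    match v with
    | inl (inr i) => z = h i
    | inr u => ~ exists i, z = h i
    | _ => False end.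
  move=> z; have [[i ->]|] := pselect (exists i, z = h i).
    by exists (inl (inr i)).
  by exists (inr u0).
pose r (v : (X + Z) + U) : (X + 'I_n) + U :=
  match v with inl (inl x) => inl (inl x) | inl (inr z) => g z | inr u =>
    inr u end.
exists n, h, (fun e => sat (env e) (rename r t)); split=> //.
  apply: dfn_sat => u H; have [[[x|z]|u'] vt E] := occurs_rename H => //.
    by have := gP z; rewrite -[g z]/(r (inl (inr z))) -E => -[]; exact: hP.
  by case: E vt => -> /tB.
move=> x z; rewrite tP sat_rename; apply: sat_occurs => -[[y|z']|u] //= vt.
have [i iE] := hP _ vt; have := gP z'.
by case: (g z') => [[//|j ->]|u []] //; exists i.
Qed.

Lemma dfn_eq B Z (i j : Z) : dfn B (fun e : Z -> U => e i = e j).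
Proof.
by exists (@fEq L (Z + U)%type (tVar (inl i)) (tVar (inl j))); split=> // u [].
Qed.

Lemma dfn_split M W Z (P : (W -> U) -> Prop) (z : Z -> U) :
  dfn (M `|` range z) P ->
  exists2 Q : (W + Z -> U) -> Prop, dfn M Q & forall w, P w <-> Q (jn w z).
Proof.
move=> [t [tB tP]].
have /choice[g gP] : forall u, exists v : Z + U,
    match v with inl i => z i = u | inr u' => u' = u /\ forall i, z i <> u end.
  move=> u; have [[i iu]|N] := pselect (exists i, z i = u);
    first by exists (inl i).
  by exists (inr u); split=> // i iu; apply: N; exists i.
pose r (v : W + U) : (W + Z) + U := match v with
  | inl w => inl (inl w)
  | inr u => match g u with inl i => inl (inr i) | inr u' => inr u' end end.
exists (fun e => sat (env e) (rename r t)).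
  apply: dfn_sat => u H; have [[w|u'] vt] := occurs_rename H => //=.
  have := gP u'; case: (g u') => [//|u''] [-> N] [->].
  by have [//|[i _ iu]] := tB _ vt; case: (N i).
move=> w; rewrite tP sat_rename; apply: sat_occurs => -[w'|u] //= _.
by rewrite /r; have := gP u; case: (g u) => [i /= ->|u' [/= -> _]].
Qed.

Lemma dfn_finl B X Z (P : (X + Z -> U) -> Prop) : dfn B P ->
  exists n (h : 'I_n -> X) (P' : ('I_n + Z -> U) -> Prop),
    [/\ injective h, dfn B P' & forall x z, P (jn x z) <-> P' (jn (x \o h) z)].
Proof.
move=> dP.
pose sw X Z (v : X + Z) : Z + X := match v with inl x => inr x | inr z =>
  inl z end.
have swE X' Z' (x : X' -> U) (z : Z' -> U) : jn x z \o @sw Z' X' = jn z x.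
  by apply/funext => -[].
have [n [h [P' [hI dP' PP']]]] := dfn_fin (dfn_comp (@sw X Z) dP).
exists n, h, (fun e => P' (e \o @sw Z 'I_n)); split=> //; first exact: dfn_comp.
by move=> x z; rewrite swE -PP' swE.
Qed.

End Definable.

(** * Elementary submodels *)

Section Elementary.
Variables (L : language) (U : structure L) (M : set U).
Hypothesis Mel : elementary_submodel M.

Lemma elem_ex : exists m, M m.
Proof. by case: Mel => -[[m Mm]] _; exists m. Qed.

(** Elementarity is given for the variables in [ 'I_n ]; a formula in any set of
    variables is a renaming of such a formula. *)
Lemma elem_sat : exists (D_ne : inhabited {x : U | M x}) (D_cl : fun_closed M),
  forall V (phi : formula L V) (e : V -> {x : U | M x}),
    @sat L (substructure D_ne D_cl) _ e phi <-> sat (fun v => sval (e v)) phi.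
Proof.
have [D_ne [D_cl H]] := Mel; exists D_ne, D_cl => V phi e.
have [m0] := D_ne.
have [n [h [_ _ hP]]] := finite_enum (finite_occurs phi).
have /choice[g gP] : forall v, exists i : 'I_n.+1,
    occurs v phi -> exists2 j, i = lift ord0 j & v = h j.
  move=> v; have [/hP[i ->]|N] := pselect (occurs v phi).
    by exists (lift ord0 i) => _; exists i.
  by exists ord0.
pose e' i := if unlift ord0 i is Some j then e (h j) else m0.
have e'g v : occurs v phi -> e' (g v) = e v.
  by move=> /gP[j -> ->]; rewrite /e' liftK.
rewrite -(@sat_occurs L (substructure D_ne D_cl) _ (e' \o g)) // -sat_rename H.
by rewrite sat_rename; apply: sat_occurs => v /e'g /= ->.
Qed.

(** The Tarski-Vaught property, for finitely many variables at once. *)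
Lemma elem_exs V (phi : formula L V) (s : seq V) (e : V -> U) :
  (forall v, occurs v phi -> ~ List.In v s -> M (e v)) -> sat e phi ->
  exists e', [/\ forall v, ~ List.In v s -> e' v = e v,
    forall v, List.In v s -> M (e' v) & sat e' phi].
Proof.
have [D_ne [D_cl H]] := elem_sat; have [m0 Mm0] := elem_ex.
elim: s e => [|w s IH] e eM eP; first by exists e.
pose e0 v : {x : U | M x} :=
  if pselect (M (e v)) is left p then exist _ (e v) p else exist _ m0 Mm0.
have e0E v : M (e v) -> sval (e0 v) = e v by rewrite /e0; case: pselect.
have : sat e (fExs (w :: s) phi) by rewrite sat_exs; exists e.
rewrite -(sat_occurs (e := fun v => sval (e0 v))); last first.
  by move=> v vo; have [vp vs] := occurs_exs vo; apply: e0E; exact: eM.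
rewrite -H [fExs _ _]/= sat_ex => -[[u Mu]].
rewrite H => uP.
have {}uP : sat (upd e w u) (fExs s phi).
  move: uP; apply: (iffLR (sat_occurs _)) => v vo; rewrite /upd.
  case: asboolP => // vw; apply: e0E; have [vp vs] := occurs_exs vo.
  by apply: eM => // -[/esym|].
have [e1 e1E e1P] := iffLR (sat_exs _ _ _) uP.
have [|e' [E1 E2 E3]] := IH e1 _ e1P.
  move=> v vp vs; rewrite e1E // /upd; case: asboolP => // vw.
  by apply: eM => // -[/esym|].
exists e'; split=> // v.
  move=> nv; rewrite E1 ?e1E /upd; last 2 first.
  - by move=> vs; apply: nv; right.
  - by move=> vs; apply: nv; right.
  by case: asboolP => // vw; case: nv; left.
move=> [<-|vs]; last exact: E2.
have [ws|ws] := pselect (List.In w s); first exact: E2.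
by rewrite E1 // e1E // /upd; case: asboolP.
Qed.

Lemma elem_dfn Z (P : (Z -> U) -> Prop) e : dfn M P -> P e ->
  exists2 e', (forall z, M (e' z)) & P e'.
Proof.
have [m0 Mm0] := elem_ex.
move=> [t [tM tP]] /tP Pe.
have /finite_list[s sP] : finite_set
    [set v | occurs v t /\ if v is inl _ then true else false].
  by apply: sub_finite_set (finite_occurs t) => v [].
have [|e' [E1 E2 E3]] := elem_exs (s := s) _ Pe.
  move=> [z|u] vt ns; last exact: tM.
  by case: ns; apply/sP.
exists (fun z => if `[< List.In (inl z) s >] then e' (inl z) else m0).
  by move=> z; case: asboolP => // /E2.
apply/tP; apply: (iffLR (sat_occurs _) E3) => -[z|u] vt /=.
  by case: asboolP => // -[]; apply/sP.
by rewrite E1 // => /sP[].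
Qed.

Lemma elem_jn W Z (P : (W + Z -> U) -> Prop) x z : dfn M P ->
  (forall i, M (z i)) -> P (jn x z) ->
  exists2 x', (forall i, M (x' i)) & P (jn x' z).
Proof.
move=> dP zM Pz.
by apply: (@elem_dfn W (fun x' => P (jn x' z)) x) => //; apply: dfn_fix dP.
Qed.

End Elementary.

(** * Small sets *)

Section Cardinals.

Lemma card_le_fun S T (A : set S) (B : set T) (f : S -> T) :
  (forall x, A x -> B (f x)) ->
  (forall x y, A x -> A y -> f x = f y -> x = y) -> (A #<= B)%card.
Proof.
move=> fB fI.
have [g] : $|{injfun A >-> B}|.
  by apply/injfunPex; exists f => // x y /set_mem Ax /set_mem Ay; exact: fI.
exact: inj_card_le g.
Qed.

Lemma card_leP' S T (A : set S) (B : set T) : (A #<= B)%card <->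
  exists R : S -> T -> Prop, (forall x, A x -> exists2 y, B y & R x y) /\
    (forall x x' y, A x -> A x' -> R x y -> R x' y -> x = x').
Proof.
split=> [/card_leP[f]|[R [R1 R2]]].
  exists (fun x y => exists h : x \in A, val (f (SigSub h)) = y); split.
    move=> x Ax; exists (val (f (SigSub (mem_set Ax)))).
      by apply: set_mem; exact: (valP (f _)).
    by exists (mem_set Ax).
  move=> x x' y Ax Ax' [h <-] [h' /val_inj /esym E].
  have := @inj _ _ _ f _ _ _ _ E; rewrite !in_setT => /(_ isT isT).
  by case.
elim/Ppointed: T => T in B R R1 R2 *.
  suff -> : A = set0 by exact: card_ge0.
  by apply/seteqP; split=> // x /R1[y]; rewrite emptyE.
have /choice[f fP] : forall x, exists y, A x -> B y /\ R x y.
  move=> x; have [/R1[y By xy]|Ax] := pselect (A x); first by exists y.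
  by exists point.
apply: (@card_le_fun _ _ _ _ f) => [x /fP[]//|x y Ax Ay E].
by apply: (R2 x y (f x)) => //; [case: (fP x Ax)|rewrite E; case: (fP y Ay)].
Qed.

(** A maximal partial injection is total on one side. *)
Lemma card_total S T (A : set S) (B : set T) : (A #<= B)%card \/ (B #<= A)%card.
Proof.
pose P (G : set (S * T)) := [/\ forall p, G p -> A p.1 /\ B p.2,
  forall x x' y, G (x, y) -> G (x', y) -> x = x' &
  forall x y y', G (x, y) -> G (x, y') -> y = y'].
have [F FP tot|G [[GAB G1 G2] Gmax]] := @Zorn_bigcup _ P.
  have two p q : (\bigcup_(X in F) X) p -> (\bigcup_(X in F) X) q ->
      exists X, [/\ F X, X p & X q].
    move=> [X FX Xp] [Y FY Yq]; have [XY|YX] := tot _ _ FX FY.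
      by exists Y; split=> //; exact: XY.
    by exists X; split=> //; exact: YX.
  split=> [p [X /FP[XAB _ _] /XAB]//|x x' y Gx Gx'|x y y' Gx Gx'].
    have [X [/FP[_ X1 _] Xx Xx']] := two _ _ Gx Gx'; exact: X1 Xx Xx'.
  have [X [/FP[_ _ X2] Xx Xx']] := two _ _ Gx Gx'; exact: X2 Xx Xx'.
have [allA|/existsNP[a /not_implyP[Aa Na]]] :=
    pselect (forall a, A a -> exists b, G (a, b)).
  left; apply/card_leP'; exists (fun a b => G (a, b)); split.
    by move=> x /allA[b Gb]; exists b => //; case: (GAB _ Gb).
  by move=> x x' y _ _; exact: G1.
have [allB|/existsNP[b /not_implyP[Bb Nb]]] :=
    pselect (forall b, B b -> exists a, G (a, b)).
  right; apply/card_leP'; exists (fun b a => G (a, b)); split.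
    by move=> x /allB[b Gb]; exists b => //; case: (GAB _ Gb).
  by move=> x x' y _ _; exact: G2.
case: (Gmax (G `|` [set (a, b)])).
  split=> [p Gp|]; first by left.
  by move=> /(_ (a, b)) H; apply: Na; exists b; apply: H; right.
split=> [p [/GAB//|->//]|x x' y|x y y'].
- move=> [Gx|[-> ->]] [Gx'|[]//]; first exact: G1 Gx Gx'.
    by move=> -> E; case: Nb; exists x; rewrite -E.
  by case: Nb; exists x'.
- move=> [Gx|[-> ->]] [Gx'|[]//]; first exact: G2 Gx Gx'.
    by move=> E _; case: Na; exists y; rewrite -E.
  by case: Na; exists y'.
Qed.

(** Up to a finite set, [B] is a disjoint union of copies of [nat], by
    maximality, and the copies double separately. *)
Lemma infinite_double T (B : set T) : infinite_set B ->
  exists d : T -> bool -> T, (forall x b, B x -> B (d x b)) /\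
    forall x x' b b', B x -> B x' -> d x b = d x' b' -> x = x' /\ b = b'.
Proof.
move=> Binf.
pose P (G : set (nat -> T)) := (forall f n, G f -> B (f n)) /\
  (forall f g n m, G f -> G g -> f n = g m -> f = g /\ n = m).
have [F FP tot|G [[GB GI] Gmax]] := @Zorn_bigcup _ P.
  split=> [f n [X /FP[XB _] Xf]|f g n m [X FX Xf] [Y FY Yg]]; first exact: XB.
  have [XY|YX] := tot _ _ FX FY.
    by have [_ YI] := FP _ FY; exact: YI (XY _ Xf) Yg.
  by have [_ XI] := FP _ FX; exact: XI Xf (YX _ Yg).
pose E := [set x | B x /\ forall f n, G f -> x <> f n].
have Efin : finite_set E.
  apply: contrapT => /infiniteP/card_leP'[R [R1 R2]].
  have /choice[h hP] : forall n : nat, exists x, E x /\ R n x.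
    by move=> n; have [x Ex nx] := R1 n I; exists x.
  (* a sequence outside the union of [G] could be added to [G] *)
  case: (Gmax (G `|` [set h])).
    split=> [p Gp|]; first by left.
    move=> /(_ h) H; have [[_ /(_ h 0) Eh] _] := hP 0.
    by apply: Eh => //; apply: H; right.
  split=> [f n [/GB//|-> /=]|f g n m]; first by case: (hP n) => -[].
  move=> [Gf|->] [Gg|->]; first exact: GI.
  - by move=> e; have [[_ /(_ f n Gf)]] := hP m; rewrite e.
  - by move=> e; have [[_ /(_ g m Gg)]] := hP n; rewrite e.
  - move=> e; split=> //; apply: (R2 n m (h n)) => //; first by case: (hP n).
    by rewrite e; case: (hP m).
have [f0 Gf0] : exists f, G f.
  apply: contrapT => N; apply: Binf; apply: sub_finite_set Efin => x Bx.
  by split=> // f n Gf; case: N; exists f.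
have [e [h [_ _ hE]]] := finite_enum Efin.
have /choice[c cP] : forall x, exists c : (nat -> T) * nat, B x -> G c.1 /\
    ((e <= c.2 /\ x = c.1 (c.2 - e)) \/ exists i : 'I_e, c.2 = i /\ x = h i).
  move=> x; have [[f [n [Gf ->]]]|N] := pselect (exists f n, G f /\ x = f n).
    by exists (f, (n + e)%N) => _; split=> //; left; rewrite leq_addl addnK.
  have [Bx|nB] := pselect (B x); last by exists (f0, 0).
  have [|i xi] := hE x; first by split=> // f n Gf E'; apply: N; exists f, n.
  by exists (f0, val i) => _; split=> //; right; exists i.
have cI x y : B x -> B y -> c x = c y -> x = y.
  move=> /cP[_ Hx] /cP[_ Hy] E'; rewrite {}E' in Hx.
  case: Hx Hy => [[l xE]|[i [ci xE]]] [[l' yE]|[j [cj yE]]].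
  - exact: etrans xE (esym yE).
  - by move: l; rewrite cj leqNgt ltn_ord.
  - by move: l'; rewrite ci leqNgt ltn_ord.
  - by rewrite xE yE; congr (h _); apply: val_inj; rewrite /= -ci -cj.
exists (fun x b => (c x).1 ((c x).2.*2 + b)); split.
  by move=> x b /cP[Gc _]; exact: GB.
move=> x y b b' Bx By E'.
have [Gx _] := cP _ Bx; have [Gy _] := cP _ By.
have [E1 E2] := GI _ _ _ _ Gx Gy E'.
have Eb : b = b' by have := congr1 odd E2; rewrite !oddD !odd_double !oddb.
split=> //; apply: cI => //.
move: E2; rewrite Eb => /addIn/double_inj E2.
by case: (c x) (c y) E1 E2 => ? ? [? ?] /= -> ->.
Qed.

Lemma card_le_setU T S (A B : set T) (C : set S) : infinite_set C ->
  (A #<= C)%card -> (B #<= C)%card -> (A `|` B #<= C)%card.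
Proof.
move=> Cinf /card_leP'[R [R1 R2]] /card_leP'[R' [R1' R2']].
have [d [dC dI]] := infinite_double Cinf.
apply/card_leP'.
exists (fun x y => (A x /\ exists2 z, C z & R x z /\ y = d z true) \/
   (~ A x /\ exists2 z, C z & R' x z /\ y = d z false)); split.
  move=> x ABx; have [Ax|nA] := pselect (A x).
    have [z Cz xz] := R1 _ Ax; exists (d z true); first exact: dC.
    by left; split=> //; exists z.
  case: ABx => // /R1'[z Cz xz]; exists (d z false); first exact: dC.
  by right; split=> //; exists z.
move=> x x' y ABx ABx' [[Ax [z Cz [xz ->]]]|[nA [z Cz [xz ->]]]]
  [[Ax' [z' Cz' [xz' /(dI _ _ _ _ Cz Cz')[E E']]]]|
   [nA' [z' Cz' [xz' /(dI _ _ _ _ Cz Cz')[E E']]]]] //; subst z'.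
  exact: R2 xz xz'.
by case: ABx ABx' => // Bx [//|Bx']; exact: R2' xz xz'.
Qed.

End Cardinals.

Section Small.
Variable K : Type.
Hypothesis natK : small K [set: nat].

Lemma smallN S (A : set S) : small K A <-> ~ ([set: K] #<= A)%card.
Proof.
split=> [[]//|H]; split=> //.
by have [//|] := card_total A [set: K].
Qed.

Lemma small_le S T (A : set S) (B : set T) : (A #<= B)%card ->
  small K B -> small K A.
Proof. by move=> AB /smallN nB; apply/smallN => KA; apply: nB;
  exact: card_le_trans AB. Qed.

Lemma small_countable S (A : set S) : countable A -> small K A.
Proof. by move=> cA; exact: small_le natK. Qed.

Lemma small_setU T (A B : set T) : small K A -> small K B -> small K (A `|` B).
Proof.
wlog AB : A B / (A #<= B)%card => [H sA sB|].
  by have [AB|BA] := card_total A B; [|rewrite setUC]; apply: H.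
move=> sA sB; have [fB|iB] := pselect (finite_set B).
  apply: small_countable; apply: finite_set_countable; rewrite finite_setU.
  by split=> //; exact: card_le_finite AB fB.
by apply: small_le sB; apply: card_le_setU => //; exact: card_lexx.
Qed.

Lemma small_range Z T (f : Z -> T) : small K [set: Z] -> small K (range f).
Proof. by apply: small_le; exact: card_image_le. Qed.

Lemma small_sum S T : small K [set: S] -> small K [set: T] ->
  small K [set: S + T].
Proof.
move=> sS sT.
have -> : [set: S + T] = range inl `|` range inr.
  by apply/seteqP; split=> // -[x|y] _; [left|right]; eexists.
by apply: small_setU; exact: small_range.
Qed.

End Small.

(** * Saturation for small tuples of variables *)

Section Saturation.
Variables (L : language) (K : Type) (U : structure L).
Hypothesis natK : small K [set: nat].
Hypothesis Usat : saturated K U.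

(** The variables are realized one at a time, each over the parameters chosen so
    far, which form a small set. *)
Lemma realize_type (B : set U) Z (S : set (formula L (Z + U))) :
  small K B -> small K [set: Z] -> (forall t, S t -> fml_over B t) ->
  consistent S -> exists e : Z -> U, realizes e S.
Proof.
move=> sB sZ SB Scons.
(* the partial assignments [G] that remain compatible with [S] *)
pose P (G : set (Z * U)) := forall F, finite_set F -> F `<=` S ->
  exists2 e : Z -> U, (forall z u, G (z, u) -> e z = u) & realizes e F.
have Pfun G : P G -> forall z u u', G (z, u) -> G (z, u') -> u = u'.
  move=> PG z u u' Gu Gu'.
  by have [|//|e eG _] := PG set0;
    [exact: finite_set0|rewrite -(eG _ _ Gu) (eG _ _ Gu')].
have [F FP tot|G [PG Gmax]] := @Zorn_bigcup _ P.
  have [[X0 FX0]|F0] := pselect (F !=set0); last first.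
    move=> F' fF' F'S; have [e eF] := Scons _ fF' F'S.
    by exists e => // z u [X FX]; case: F0; exists X.
  have common (s : seq Z) : exists2 X, F X &
      forall z u, List.In z s -> (\bigcup_(X in F) X) (z, u) -> X (z, u).
    elim: s => [|z s [X FX XP]]; first by exists X0.
    have [[u0 [Y FY Yu0]]|N] := pselect (exists u, (\bigcup_(X in F) X) (z, u)).
      have YP u : (\bigcup_(X in F) X) (z, u) -> Y (z, u).
        move=> [Y' FY' Yu]; suff -> : u = u0 by [].
        have [Y'Y|YY'] := tot _ _ FY' FY.
          by apply: (Pfun _ (FP _ FY) z) => //; exact: Y'Y.
        by apply: (Pfun _ (FP _ FY') z) => //; exact: YY'.
      have [XY|YX] := tot _ _ FX FY.
        by exists Y => // z' u [<-|zs] H; [exact: YP|exact/XY/XP].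
      by exists X => // z' u [<-|zs] H; [exact/YX/YP|exact: XP].
    by exists X => // z' u [<-|zs] H; [case: N; exists u|exact: XP].
  move=> F' fF' F'S.
  have /finite_list[s sP] : finite_set (\bigcup_(t in F') [set z | occurs (inl z) t]).
    apply: bigcup_finite => // t _.
    by apply: (@finite_preimage _ _ _ inl) (finite_occurs t) => x y _ _ [].
  have [X FX XP] := common s.
  have [e eX eF] := FP _ FX _ fF' F'S.
  have /choice[e' e'P] : forall z, exists u, (forall u', (\bigcup_(X in F) X) (z, u') -> u = u')
      /\ (List.In z s -> u = e z).
    move=> z; have [zs|nzs] := pselect (List.In z s).
      by exists (e z); split=> // u' /(XP _ _ zs)/eX.
    have [[u [Y FY Yu]]|N] := pselect (exists u, (\bigcup_(X in F) X) (z, u)).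
      exists u; split=> // u' [Y' FY' Yu'].
      have [Y'Y|YY'] := tot _ _ FY' FY.
        by apply: (Pfun _ (FP _ FY) z) => //; exact: Y'Y.
      by apply: (Pfun _ (FP _ FY') z) => //; exact: YY'.
    by exists (e z); split=> // u' Gu; case: N; exists u'.
  exists e' => [z u zu|t Ft]; first by have [/(_ _ zu)] := e'P z.
  apply: (iffLR (sat_occurs _) (eF _ Ft)) => -[z|u] //= zt.
  by have [_ ->//] := e'P z; apply/sP; exists t.
have [dom|/existsNP[z0 z0N]] := pselect (forall z, exists u, G (z, u)).
  have [e eG] := choice dom; exists e => t St.
  have [||e' e'G] := PG [set t]; [exact: finite_set1|by move=> ? ->|].
  suff -> : e = e' by apply.
  by apply/funext => z; rewrite (e'G z (e z)).
(* [x] realizes the type of a value at [z0] over the values already chosen *)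
pose B' := B `|` [set u | exists z, G (z, u)].
have sB' : small K B'.
  apply: small_setU => //; apply: small_le sZ; apply/card_leP'.
  exists (fun u z => G (z, u)); split; first by move=> u [z zu]; exists z.
  by move=> u u' z _ _; exact: Pfun.
pose Q (F : set (formula L (Z + U))) (x : 'I_1 -> U) :=
  exists e : Z -> U, [/\ forall z u, G (z, u) -> e z = u, e z0 = x ord0 & realizes e F].
have Qdfn F : finite_set F -> F `<=` S -> dfn B' (Q F).
  move=> fF FS; have [s sP] := finite_list fF.
  have d1 : dfn B (fun e : Z -> U => realizes e F).
    have d0 t : dfn B (fun e : Z -> U => F t -> sat (env e) t); last first.
      apply: dfn_ext (dfn_forall_seq (s := s) (fun t _ => d0 t)) => e.
      by split=> [H t Ft|H t /sP Ft _]; apply: H => //; exact/sP.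
    have [Ft|nF] := pselect (F t).
      apply: dfn_ext (dfn_sat (SB _ (FS _ Ft))) => e; split=> // H; exact: H.
    by apply: dfn_ext (@dfn_true _ U B Z) => e; split.
  have /choice[g gP] : forall z, exists v : (Z + 'I_1) + U,
      match v with inl (inl z') => z' = z /\ z <> z0 /\ ~ exists u, G (z, u)
      | inl (inr i) => z = z0 | inr u => G (z, u) end.
    move=> z; have [->|zz0] := pselect (z = z0);
      first by exists (inl (inr ord0)).
    have [[u Gu]|N] := pselect (exists u, G (z, u)); first by exists (inr u).
    by exists (inl (inl z)).
  have : dfn B' (fun e : Z + 'I_1 -> U => realizes (fun z => env e (g z)) F).
    apply: (dfn_subst (P := fun e => realizes e F)).
      by move=> z u E; right; exists z; have := gP z; rewrite E.
    by apply: dfn_sub d1; left.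
  move/dfn_ex; apply: dfn_ext => x; split=> [[y H]|[e [eG ez0 eF]]].
    exists (fun z => env (jn y x) (g z)); split=> //.
      move=> z u Gu; have := gP z; case: (g z) => [[z'|i]|u'] /=.
      - by move=> [_ [_ []]]; exists u.
      - by move=> E; case: z0N; exists u; rewrite -E.
      - by move=> Gu'; exact: Pfun PG _ _ _ Gu' Gu.
    have := gP z0; case: (g z0) => [[z'|i]|u'] /=; first by move=> [_ []].
      by rewrite ord1.
    by move=> Gu; case: z0N; exists u'.
  exists e; suff -> : (fun z => env (jn e x) (g z)) = e by [].
  apply/funext => z; have := gP z; case: (g z) => [[z'|i]|u'] /=.
  - by case=> ->.
  - by rewrite ord1 => ->.
  - by move=> /eG.
pose S1 := [set t : formula L ('I_1 + U) | fml_over B' t /\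
  exists F, [/\ finite_set F, F `<=` S & forall x, Q F x <-> sat (env x) t]].
have [t []//||x xS1] := Usat (S := S1) sB'.
  move=> F1 fF1 F1S.
  have /choice[F FP] : forall t, exists F, F1 t ->
      [/\ finite_set F, F `<=` S & forall x, Q F x <-> sat (env x) t].
    move=> t; have [/F1S[_ [F HF]]|N] := pselect (F1 t); first by exists F.
    by exists set0.
  have [||e eG eF] := PG (\bigcup_(t in F1) F t).
  - by apply: bigcup_finite => // t /FP[].
  - by move=> t [t' /FP[_ F't _] /F't].
  exists (fun=> e z0) => t F1t; have [_ _ H] := FP _ F1t; apply/H.
  by exists e; split=> // t' Ft'; apply: eF; exists t.
case: (Gmax (G `|` [set (z0, x ord0)])).
  split=> [p Gp|]; first by left.
  by move=> /(_ (z0, x ord0)) H; apply: z0N; exists (x ord0); apply: H; right.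
move=> F fF FS; have [t [tB' tP]] := Qdfn _ fF FS.
have : Q F x by apply/tP; apply: xS1; split=> //; exists F.
by move=> [e [eG ez0 eF]]; exists e => // z u [/eG//|[-> ->]].
Qed.

Lemma realize_dfn (B : set U) Z (S : set ((Z -> U) -> Prop)) :
  small K B -> small K [set: Z] -> (forall P, S P -> dfn B P) ->
  (forall s : seq ((Z -> U) -> Prop), (forall P, List.In P s -> S P) ->
    exists e, forall P, List.In P s -> P e) ->
  exists e : Z -> U, forall P, S P -> P e.
Proof.
move=> sB sZ Sdfn Scons.
pose S' := [set t : formula L (Z + U) | fml_over B t /\ S (fun e =>
  sat (env e) t)].
have [||e eS'] := @realize_type B Z S' sB sZ; first by move=> t [].
  move=> F /finite_list[s sP] FS.
  have [|e eP] := Scons [seq (fun e => sat (env e) t) | t <- s].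
    move=> P; have : forall t, List.In t s -> S (fun e => sat (env e) t).
      by move=> t /sP/FS[].
    elim: s {sP} => //= t s IH H [<-|]; first by apply: H; left.
    by apply: IH => t' t's; apply: H; right.
  exists e => t /sP ts; apply: (eP (fun e => sat (env e) t)).
  elim: s ts {sP eP} => //= t' s IH [->|ts]; [by left|right; exact: IH].
exists e => P SP; have [t [tB tP]] := Sdfn _ SP; apply/tP; apply: eS';
  split=> //.
suff <- : P = (fun e => sat (env e) t) by [].
by apply/funext => e'; apply/propext.
Qed.

End Saturation.

(** * Ultrafilters and their tensor products *)

Section Ultra.

Definition ultra T (F : set_system T) :=
  ProperFilter F /\ forall A, F A \/ F (~` A).

Section UltraTheory.
Variables (T : Type) (F : set_system T).
Hypothesis uF : ultra F.
Implicit Types A B : set T.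

Lemma ultraI A B : F A -> F B -> F (A `&` B).
Proof. by case: uF => pF _; exact: filterI. Qed.

Lemma ultraS A B : A `<=` B -> F A -> F B.
Proof. by case: uF => pF _; exact: filterS. Qed.

Lemma ultraT A : (forall x, A x) -> F A.
Proof. by case: uF => pF _ H; apply: (filterS _ filterT) => x _. Qed.

Lemma ultra_ex A : F A -> exists x, A x.
Proof. by case: uF => pF _ /filter_ex. Qed.

Lemma ultraN A : ~ F A -> F (~` A).
Proof. by case: uF => _ /(_ A)[]. Qed.

Lemma ultra_seq I (s : seq I) (P : I -> set T) :
  (forall i, List.In i s -> F (P i)) -> F [set x | forall i, List.In i s -> P i x].
Proof.
elim: s => [|i s IH] H; first by apply: ultraT => x i [].
have Hi : F (P i) by apply: H; left.
have {}IH := IH (fun j js => H j (or_intror js)).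
apply: ultraS (ultraI Hi IH) => x [xi xs] j [<-//|]; exact: xs.
Qed.

End UltraTheory.

Lemma ultra_base T (D : set (set T)) : D !=set0 ->
  (forall A B, D A -> D B -> D (A `&` B)) -> (forall A, D A -> A !=set0) ->
  exists F, ultra F /\ D `<=` F.
Proof.
move=> [A0 DA0] DI Dne.
have FF : Filter (filter_from D id).
  apply: filter_from_filter; first by exists A0.
  by move=> A B DA DB; exists (A `&` B) => //; exact: DI.
have PF : ProperFilter (filter_from D id) by exact: filter_from_proper.
have [G [uG FG]] := ultraFilterLemma PF.
exists G; split; last by move=> A DA; apply: FG; exists A.
by split=> [|A]; [exact: ultra_proper|exact: in_ultra_setVsetC].
Qed.

Lemma ultra_principal T (x : T) : ultra [set A : set T | A x].
Proof.
split=> [|A]; last by have [Ax|Ax] := pselect (A x); [left|right].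
by split; [move=> H; exact: H|split=> // A B AB; exact: AB].
Qed.

Definition push S T (f : S -> T) (F : set_system S) : set_system T :=
  [set A | F (f @^-1` A)].

Lemma ultra_push S T (f : S -> T) F : ultra F -> ultra (push f F).
Proof.
move=> [pF uF]; split=> [|A]; last exact: uF.
exact: fmap_proper_filter.
Qed.

(** The first coordinate is quantified first: it realizes [F] over the second
    one. *)
Definition tensor S T (F : set_system S) (G : set_system T) :
  set_system (S * T) :=
  [set A | F [set x | G [set y | A (x, y)]]].

Lemma ultra_tensor S T (F : set_system S) (G : set_system T) :
  ultra F -> ultra G -> ultra (tensor F G).
Proof.
move=> uF uG; split=> [|A].
  split; first by move=> /(ultra_ex uF)[x /(ultra_ex uG)[]].
  split.
  - by apply: (ultraT uF) => x; exact: (ultraT uG).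
  - move=> A B /= FA FB; apply: (ultraS uF _ (ultraI uF FA FB)) => x [Ax Bx].
    exact: (ultraI uG).
  - move=> A B AB; apply: (ultraS uF) => x; apply: (ultraS uG) => y; exact: AB.
have [FA|/(ultraN uF) FA] := pselect (tensor F G A); first by left.
right; apply: (ultraS uF _ FA) => x Ax; exact: (ultraN uG).
Qed.

Lemma tensor_fst S T (F : set_system S) (G : set_system T) A :
  ultra G -> F A -> ultra F -> tensor F G [set q | A q.1].
Proof. by move=> uG FA uF; apply: (ultraS uF _ FA) => x Ax;
  exact: (ultraT uG). Qed.

Lemma tensor_snd S T (F : set_system S) (G : set_system T) A :
  ultra F -> G A -> tensor F G [set q | A q.2].
Proof. by move=> uF GA; exact: (ultraT uF). Qed.

Lemma push_tensor S T V (F : set_system S) (G : set_system T) (f : S * T ->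
  V) A B C :
  ultra F -> ultra G -> F A -> G B -> (forall x y, A x -> B y -> C (f (x, y))) ->
  push f (tensor F G) C.
Proof.
move=> uF uG FA GB H; apply: (ultraS uF _ FA) => x Ax.
by apply: (ultraS uG _ GB) => y; exact: H.
Qed.

End Ultra.

(** * Invariant types and generic coheirs *)

Section Points.
Variables (L : language) (K : Type) (U : structure L).
Hypothesis natK : small K [set: nat].
Hypothesis Usat : saturated K U.
Variable M : set U.
Hypothesis sM : small K M.

(** An ultrafilter on the tuples of [M] is a global coheir over [M]. *)
Definition onM Z (F : set_system (Z -> U)) := F [set e | forall z, M (e z)].

(** The tuple [d] realizes the restriction to [M] of the global type whose
    formulas are those that define a set in [F]. *)
Definition realizes_lim Z (F : set_system (Z -> U)) (d : Z -> U) :=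
  forall P, dfn M P -> F P -> P d.

Lemma realizes_lim_ex Z (F : set_system (Z -> U)) :
  small K [set: Z] -> ultra F -> exists d, realizes_lim F d.
Proof.
move=> sZ uF.
have [P []//||d dP] := realize_dfn natK Usat
  (S := [set P | dfn M P /\ F P]) sM sZ.
  move=> s sS; have /(ultra_ex uF)[e eP] : F [set e | forall P, List.In P s -> P e].
    by apply: (ultra_seq uF (P := id)) => P /sS[].
  by exists e.
by exists d => P PM FP; apply: dP.
Qed.

Lemma realizes_lim_iff Z (F : set_system (Z -> U)) d P : ultra F ->
  realizes_lim F d ->
  dfn M P -> F P <-> P d.
Proof.
move=> uF Fd dP; split; first exact: Fd.
move=> Pd; apply: contrapT => /(ultraN uF) NP.
by have : ~ P d by apply: (Fd (fun e => ~ P e)) => //; exact: dfn_not.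
Qed.

Lemma realizes_lim_tp Z (F : set_system (Z -> U)) d d' : ultra F ->
  realizes_lim F d ->
  realizes_lim F d' -> tp d M = tp d' M.
Proof.
move=> uF Fd Fd'; apply/tp_dfn => P dP Pd; apply: Fd' => //.
exact/(realizes_lim_iff uF Fd dP).
Qed.

End Points.

Section GlobalType.
Variables (L : language) (K : Type) (U : structure L).
Hypothesis natK : small K [set: nat].
Hypothesis Usat : saturated K U.
Variable M : set U.
Hypothesis sM : small K M.
Hypothesis Mel : elementary_submodel M.
Variables (Y : Type) (p : set (formula L (Y + U))).
Hypothesis pglob : global_type p.

Definition in_type (P : (Y -> U) -> Prop) :=
  exists2 t, p t & forall e, P e <-> sat (env e) t.

Lemma in_type_seq (s : seq (formula L (Y + U))) :
  (forall t, List.In t s -> p t) -> exists x, forall t, List.In t s -> sat (env x) t.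
Proof.
case: pglob => pc _ sp.
have [||x xs] := pc [set t | List.In t s]; [|by []|by exists x].
elim: s {sp} => [|t s IH].
  by apply: sub_finite_set (finite_set0 _) => t.
have -> : [set t' | List.In t' (t :: s)] = [set t] `|` [set t' | List.In t' s].
  by apply/seteqP; split=> t' [->|H]; by [left|right].
by rewrite finite_setU; split=> //; exact: finite_set1.
Qed.

Lemma in_type_incl (P Q R : (Y -> U) -> Prop) : in_type P -> in_type Q ->
  dfn setT R ->
  (forall x, P x -> Q x -> R x) -> in_type R.
Proof.
case: pglob => _ pdec [t pt tP] [t' pt' tQ] [t'' [_ tR]] PQR.
exists t'' => //; have [//|pn] := pdec t''.
have [|x xs] := in_type_seq (s := [:: t; t'; fNot t'']).
  by move=> t0 [<-|[<-|[<-|]]].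
have Px : P x by apply/tP; apply: xs; left.
have Qx : Q x by apply/tQ; apply: xs; right; left.
have : sat (env x) (fNot t'') by apply: xs; right; right; left.
by case; apply/tR; exact: PQR.
Qed.

Lemma in_typeS (P Q : (Y -> U) -> Prop) : in_type P -> dfn setT Q ->
  (forall x, P x -> Q x) -> in_type Q.
Proof. by move=> pP dQ PQ; apply: (in_type_incl pP pP dQ) => x Px _;
  exact: PQ. Qed.

Lemma in_type_ex P : in_type P -> exists x, P x.
Proof.
move=> [t pt tP]; have [|x xt] := in_type_seq (s := [:: t]);
  first by move=> ? [<-|].
by exists x; apply/tP; apply: xt; left.
Qed.

Lemma in_type_dec P : dfn setT P -> in_type P \/ in_type (fun x => ~ P x).
Proof.
case: pglob => _ pdec [t [_ tP]]; have [pt|pt] := pdec t.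
  by left; exists t.
by right; exists (fNot t) => // e; rewrite tP.
Qed.

Lemma in_type_seqs (s : seq ((Y -> U) -> Prop)) :
  (forall P, List.In P s -> in_type P) -> exists x, forall P, List.In P s -> P x.
Proof.
move=> sp; suff /in_type_ex[x xs] : in_type (fun x =>
  forall P, List.In P s -> P x).
  by exists x.
elim: s sp => [|P s IH] sp.
  have [t pt] : exists t, p t.
    by case: pglob => _ /(_ fFalse)[] ?; eexists; eassumption.
  apply: (@in_typeS (fun e => sat (env e) t)) => //; first by exists t.
  by apply: dfn_ext (@dfn_true _ U setT Y) => e; split.
have hP : in_type P by apply: sp; left.
have hs := IH (fun Q Qs => sp Q (or_intror Qs)).
have dP Q : in_type Q -> dfn setT Q by move=> [t _ tP]; exists t.
apply: (in_type_incl hP hs).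
  apply: dfn_ext (dfn_and (dP _ hP) (dP _ hs)) => e; split.
    by move=> [Pe se] Q [<-//|]; exact: se.
  by move=> H; split=> [|Q Qs]; apply: H; [left|right].
by move=> x Px xs Q [<-//|]; exact: xs.
Qed.

Lemma dfn_fixT Z (P : (Y + Z -> U) -> Prop) z :
  dfn M P -> dfn setT (fun x => P (jn x z)).
Proof. exact: dfn_fix. Qed.

Section Invariant.
Hypothesis pinv : invariant_over M p.

Lemma in_type_inv Z (P : (Y + Z -> U) -> Prop) z z' : dfn M P ->
  tp z M = tp z' M ->
  in_type (fun x => P (jn x z)) -> in_type (fun x => P (jn x z')).
Proof.
move=> dP E hP; have [n [h [P' [_ [t [tM tP']] PP']]]] := dfn_fin dP.
have Eh : tp (z \o h) M = tp (z' \o h) M by exact: tp_comp.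
pose r (v : (Y + 'I_n) + U) : Y + ('I_n + U) :=
  match v with inl (inl y) => inl y | inl (inr i) => inr (inl i)
             | inr u => inr (inr u) end.
have rM : fml2_over M (rename r t).
  move=> u H; have [[[y|i]|u'] vt] := occurs_rename H => //= -[->]; exact: tM.
have hE b e : sat (env e) (inst (rename r t) b) <-> P' (jn e b).
  rewrite tP' !sat_rename.
  suff -> : ((env e \o plug (env b)) \o r) = env (jn e b) by [].
  by apply/funext => -[[y|i]|u].
have hE' z0 : in_type (fun x =>
  P (jn x z0)) <-> p (inst (rename r t) (z0 \o h)).
  split=> [[t' pt' tP]|pz]; last first.
    by exists (inst (rename r t) (z0 \o h)) => // e; rewrite hE PP'.
  case: pglob => _ /(_ (inst (rename r t) (z0 \o h)))[//|pn].
  have [|x xs] := in_type_seq (s := [:: t';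
    fNot (inst (rename r t) (z0 \o h))]).
    by move=> t0 [<-|[<-|]].
  have : sat (env x) (fNot (inst (rename r t) (z0 \o h))) by apply: xs; right;
    left.
  case; apply/hE; rewrite -PP'; apply/tP; apply: xs; by left.
by apply/hE'; apply/(pinv rM Eh)/hE'.
Qed.

(** In usual notation, [x |= p|Mz]. *)
Definition realizes_over Z (z : Z -> U) (x : Y -> U) :=
  forall P : (Y + Z -> U) -> Prop, dfn M P -> in_type (fun x' =>
    P (jn x' z)) -> P (jn x z).

Lemma realizes_over_subst Z Z' (z : Z -> U) x (g : Z' -> Z + U) :
  (forall i u, g i = inr u -> M u) -> realizes_over z x -> realizes_over (fun i => env z (g i)) x.
Proof.
move=> gM zx P dP hP.
pose g' (v : Y + Z') : (Y + Z) + U :=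
  match v with inl y => inl (inl y)
  | inr i => match g i with inl j => inl (inr j) | inr u => inr u end end.
have gE x' : (fun v => env (jn x' z) (g' v)) = jn x' (fun i => env z (g i)).
  by apply/funext => -[y|i] //=; case: (g i).
rewrite -gE; apply: (zx (fun e => P (fun v => env e (g' v)))).
  apply: dfn_subst => // -[//|i] u /=; case E: (g i) => [//|u'] [<-];
    exact: gM E.
by move: hP; under eq_fun => x' do rewrite -gE.
Qed.

Hypothesis sY : small K [set: Y].

Lemma realizes_over_ex Z (z : Z -> U) : small K [set: Z] ->
  exists x, realizes_over z x.
Proof.
move=> sZ.
have sB : small K (M `|` range z) by apply: small_setU => //;
  exact: small_range.
have [|s|x xS] := realize_dfn natK Usat (S := [set Q | exists P, [/\ dfn M P,
  in_type (fun x' => P (jn x' z)) & Q = fun x' => P (jn x' z)]]) sB sY.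
- move=> Q [P [dP _ ->]]; apply: dfn_fix dP => [u Mu|i]; first by left.
  by right; exists i.
- by move=> sS; apply: in_type_seqs => P /sS[Q [_ hQ ->]].
- by exists x => P dP hP; apply: (xS (fun x' => P (jn x' z))); exists P.
Qed.

Lemma realizes_over_tp Z (z z' : Z -> U) x x' : tp z M = tp z' M ->
  realizes_over z x -> realizes_over z' x' ->
  tp (jn x z) M = tp (jn x' z') M.
Proof.
move=> E zx zx'; apply/tp_dfn => P dP Px.
apply: zx' => //; apply: (in_type_inv dP E).
have [//|hN] := in_type_dec (dfn_fixT z dP).
by have := zx _ (dfn_not dP) hN.
Qed.

(** The sets of tuples of [M] that a global coheir must avoid in order to be
    compatible with [p] in the sense of [generic_ex]. *)
Definition tiny (A : set (Y -> U)) :=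
  exists (Z : Type) (S : set_system (Z -> U)) (d : Z -> U)
         (P : (Y + Z -> U) -> Prop) (B : set (Z -> U)),
    [/\ small K [set: Z], ultra S /\ onM M S, realizes_lim M S d,
      dfn M P /\ in_type (fun x => P (jn x d)) &
      S B /\ forall m n, (forall y, M (m y)) -> (forall z, M (n z)) ->
        A m -> B n -> ~ P (jn m n)].

(** Two witnesses live on different tuples; the tensor product of their
    ultrafilters puts them together, and invariance of [p] moves the formulas
    to a common realization of it. *)
Lemma tinyU A B : tiny A -> tiny B -> tiny (A `|` B).
Proof.
move=> [Z1 [S1 [d1 [P1 [B1 [sZ1 [uS1 S1M] dS1 [dP1 hP1] [SB1 H1]]]]]]].
move=> [Z2 [S2 [d2 [P2 [B2 [sZ2 [uS2 S2M] dS2 [dP2 hP2] [SB2 H2]]]]]]].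
pose S := push (fun q : (Z1 -> U) * (Z2 -> U) => jn q.1 q.2) (tensor S1 S2).
have uS : ultra S by apply/ultra_push/ultra_tensor.
have sZ : small K [set: Z1 + Z2] by exact: small_sum.
have [d Sd] := realizes_lim_ex natK Usat sM sZ uS.
have d1E : tp d1 M = tp (d \o inl) M.
  apply: (realizes_lim_tp uS1 dS1) => P dP SP; apply: (Sd (fun e =>
    P (e \o inl))).
    exact: dfn_comp.
  exact: (tensor_fst uS2 SP uS1).
have d2E : tp d2 M = tp (d \o inr) M.
  apply: (realizes_lim_tp uS2 dS2) => P dP SP; apply: (Sd (fun e =>
    P (e \o inr))).
    exact: dfn_comp.
  exact: (tensor_snd uS1 SP).
pose g1 (v : Y + Z1) : Y + (Z1 + Z2) := match v with inl y => inl y | inr z =>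
  inr (inl z) end.
pose g2 (v : Y + Z2) : Y + (Z1 + Z2) := match v with inl y => inl y | inr z =>
  inr (inr z) end.
have g1E x z : jn x z \o g1 = jn x (z \o inl) by apply/funext => -[].
have g2E x z : jn x z \o g2 = jn x (z \o inr) by apply/funext => -[].
exists (Z1 + Z2)%type, S, d, (fun e => P1 (e \o g1) /\ P2 (e \o g2)),
  (fun n => B1 (n \o inl) /\ B2 (n \o inr)).
have dP : dfn M (fun e => P1 (e \o g1) /\ P2 (e \o g2)).
  by apply: dfn_and; exact: dfn_comp.
split=> //.
- split=> //; apply: (push_tensor uS1 uS2 S1M S2M) => x y Mx My [z|z].
    exact: Mx.
  exact: My.
- split=> //; apply: (in_type_incl (in_type_inv dP1 d1E hP1) (in_type_inv dP2 d2E hP2)).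
    exact: (dfn_fixT d dP).
  by move=> x; rewrite g1E g2E.
- split; first by apply: (push_tensor uS1 uS2 SB1 SB2) => x y Bx By; split.
  move=> m n Mm Mn AB [Bn1 Bn2]; rewrite g1E g2E => -[Q1 Q2].
  case: AB => [Am|Bm].
    by apply: (H1 m (n \o inl)) Q1 => // z; exact: Mn.
  by apply: (H2 m (n \o inr)) Q2 => // z; exact: Mn.
Qed.

Lemma tiny_dfn P A : dfn M P -> in_type P ->
  (forall m, (forall y, M (m y)) -> A m -> ~ P m) -> tiny A.
Proof.
move=> dP hP H; have [m0 Mm0] := elem_ex Mel.
pose S := [set B : set (nat -> U) | B (fun=> m0)].
exists nat, S, (fun=> m0), (fun e => P (e \o inl)), setT; split=> //.
- by split; [exact: ultra_principal|].
- by split; [exact: dfn_comp|].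
- by split=> // m n Mm _ Am _; exact: H.
Qed.

(** A realization of [p] above [d] yields solutions in [M] above almost all the
    tuples of [M], as [M] is a model. *)
Lemma tinyNT : ~ tiny setT.
Proof.
move=> [Z [S [d [P [B [sZ [uS SM] dS [dP hP] [SB H]]]]]]].
have /(ultra_ex uS)[n [[Mn Bn] [x Px]]] :
    S (([set e | forall z, M (e z)] `&` B) `&` [set e | exists x, P (jn x e)]).
  apply: ultraI => //; first exact: ultraI.
  apply/(realizes_lim_iff uS dS); first exact: dfn_ex.
  by have [x Px] := in_type_ex hP; exists x.
have [m Mm Pm] := elem_jn Mel dP Mn Px.
exact: (H m n Mm Mn I Bn Pm).
Qed.

(** Tiny sets form a proper ideal, so an ultrafilter [Q] avoids them: whatever
    [S] is, each set of [Q] meets each set of [S] along the type of a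
    realization of [p] above [d], and these traces form the base of [R]. *)
Lemma generic_ex : exists Q : set_system (Y -> U), [/\ ultra Q, onM M Q,
  forall P, dfn M P -> in_type P -> Q P &
  forall Z (S : set_system (Z -> U)) d, small K [set: Z] -> ultra S -> onM M S ->
    realizes_lim M S d -> exists R : set_system ((Y -> U) * (Z -> U)), [/\ ultra R,
      forall A, Q A -> R [set q | A q.1], forall B, S B -> R [set q | B q.2] &
      forall P, dfn M P -> in_type (fun x => P (jn x d)) ->
        R [set q | P (jn q.1 q.2)]]].
Proof.
have [t0 [pt0 dt0]] : exists t, p t /\ dfn M (fun _ : Y -> U => True).
  have [t pt] : exists t, p t.
    by case: pglob => _ /(_ fFalse)[] ?; eexists; eassumption.
  by exists t; split=> //; exact: dfn_true.
have hT : in_type (fun=> True).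
  apply: (@in_typeS (fun e => sat (env e) t0)) => //; first by exists t0.
  exact: dfn_true.
have [||A|Q [uQ QD]] := @ultra_base _ [set A | tiny (~` A)].
- by exists setT; apply: (tiny_dfn dt0 hT) => m _; exact.
- by move=> A B tA tB /=; rewrite setCI; exact: tinyU.
- move=> tA; apply/set0P/negP => /eqP A0; apply: tinyNT.
  by move: tA; rewrite A0 /= setC0.
have Qtiny A : Q A -> ~ tiny A.
  move=> QA tA; have : Q (~` A) by apply: QD; rewrite /= setCK.
  by move=> /(ultraI uQ QA)/(ultra_ex uQ)[x []].
exists Q; split=> //.
- by apply: QD; apply: (tiny_dfn dt0 hT) => m Mm; exact.
- by move=> P dP hP; apply: QD; apply: (tiny_dfn dP hP).
move=> Z S d sZ uS SM Sd.
pose MZ := [set e : Z -> U | forall z, M (e z)].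
pose D := [set C | exists A B P, [/\ Q A, S B, dfn M P, in_type (fun x =>
  P (jn x d)) &
  C = [set q : (Y -> U) * (Z -> U) | [/\ A q.1, B q.2 & P (jn q.1 q.2)]]]].
have dT : dfn M (fun _ : Y + Z -> U => True) by exact: dfn_true.
have [|||R [uR RD]] := @ultra_base _ D.
- eexists; exists setT, setT, (fun=> True); split=> //; exact: ultraT.
- move=> _ _ [A [B [P [QA SB dP hP ->]]]] [A' [B' [P' [QA' SB' dP' hP' ->]]]].
  exists (A `&` A'), (B `&` B'), (fun e => P e /\ P' e); split.
  + exact: ultraI.
  + exact: ultraI.
  + exact: dfn_and.
  + apply: (in_type_incl hP hP') => //.
    exact: (dfn_fixT d (dfn_and dP dP')).
  + by apply/seteqP; split=> q;
    [move=> [[? ? ?] [? ? ?]]|move=> [[? ?] [? ?] [? ?]]].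
- move=> _ [A [B [P [QA SB dP hP ->]]]]; apply: contrapT => N.
  apply: (Qtiny _ QA); exists Z, S, d, P, B; split=> //;
    split=> // m n _ _ Am Bn Pmn.
  by apply: N; exists (m, n).
exists R; split=> //.
- move=> A QA; apply: (RD [set q | A q.1]).
  exists A, setT, (fun=> True); split=> //; first exact: (ultraT uS).
  by apply/seteqP; split=> q //= [].
- move=> B SB; apply: (RD [set q | B q.2]).
  exists setT, B, (fun=> True); split=> //; first exact: ultraT.
  by apply/seteqP; split=> q //= [].
- move=> P dP hP; apply: (RD [set q | P (jn q.1 q.2)]).
  exists setT, setT, P; split=> //; try exact: ultraT.
  by apply/seteqP; split=> q //= [].
Qed.

End Invariant.
End GlobalType.

(** * Tensor powers and antichains of strings *)

Section Lists.

Lemma In_mem (T : eqType) (x : T) s : List.In x s <-> x \in s.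
Proof.
elim: s => //= y s IH; rewrite inE; split=> [[->|/IH ->]|/orP[/eqP ->|/IH H]].
- by rewrite eqxx.
- by rewrite orbT.
- by left.
- by right.
Qed.

Lemma In_cat T (x : T) s s' :
  List.In x (s ++ s') <-> List.In x s \/ List.In x s'.
Proof.
elim: s => [|y s IH] /=; first by split=> [|[]]; [right|..].
by rewrite IH orA.
Qed.

Lemma In_catrev T (x : T) s s' :
  List.In x (catrev s s') <-> List.In x s \/ List.In x s'.
Proof.
elim: s s' => [|y s IH] s' /=; first by split=> [|[]]; [right|..].
by rewrite IH /=; split=> [[H|[->|H]]|[[->|H]|H]]; tauto.
Qed.

Lemma In_nth T (x0 : T) s (Q : T -> Prop) : (forall v, List.In v s -> Q v) <->
  forall i, i < size s -> Q (nth x0 s i).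
Proof.
elim: s => [|v s IH] //=; split=> [H [|i] ilt /=|H w [<-|ws]].
- by apply: H; left.
- by apply: (iffLR IH) => // w ws; apply: H; right.
- exact: (H 0).
- by apply: (iffRL IH) ws => i ilt; exact: (H i.+1).
Qed.

Lemma In_map S T (f : S -> T) s y :
  List.In y (map f s) <-> exists2 x, List.In x s & y = f x.
Proof.
elim: s => [|x s IH] /=; first by split=> // -[].
rewrite IH; split=> [[<-|[x' xs ->]]|[x' [<-|xs] ->]].
- by exists x; [left|].
- by exists x'; [right|].
- by left.
- by right; exists x'.
Qed.

Lemma In_flatten T (ss : seq (seq T)) x :
  List.In x (flatten ss) <-> exists2 s, List.In s ss & List.In x s.
Proof.
elim: ss => [|s ss IH] /=; first by split=> // -[].
rewrite In_cat IH; split=> [[H|[s' ss' H]]|[s' [<-|H] H']].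
- by exists s; [left|].
- by exists s'; [right|].
- by left.
- by right; exists s'.
Qed.

End Lists.

Section Powers.
Variables (T : Type) (Q : set_system T).
Hypothesis uQ : ultra Q.

(** The tensor powers of [Q]: the head of a list realizes [Q] over its tail. *)
Fixpoint tpow k (P : set (seq T)) : Prop :=
  if k is k'.+1 then Q [set v | tpow k' [set l | P (v :: l)]] else P [::].

Lemma ultra_tpow k : ultra (tpow k).
Proof.
elim: k => [|k IH]; first exact: ultra_principal.
exact: (ultra_push (fun q => q.1 :: q.2) (ultra_tensor uQ IH)).
Qed.

Lemma tpow_size k : tpow k [set l | size l = k].
Proof.
elim: k => //= k IH; apply: (ultraT uQ) => v.
by apply: (ultraS (ultra_tpow k) _ IH) => l /= ->.
Qed.

Lemma tpow_cat k l P :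
  tpow (k + l) P <-> tpow k [set s | tpow l [set s' | P (s ++ s')]].
Proof.
elim: k P => [|k IH] P //=.
split; apply: (ultraS uQ) => v; [exact: (iffLR (IH [set s | P (v :: s)]))|].
exact: (iffRL (IH [set s | P (v :: s)])).
Qed.

Lemma tpow_all k (A : set T) : Q A -> tpow k [set l | forall v, List.In v l ->
  A v].
Proof.
move=> QA; elim: k => [|k IH] /=; first by [].
apply: (ultraS uQ _ QA) => v Av.
by apply: (ultraS (ultra_tpow k) _ IH) => l lA w [<-|/lA].
Qed.

End Powers.

Section Trees.

(** For an antichain [A] these are all the elements of [A] of length less than
    [n]; in general only the minimal ones are listed, which makes the recursion
    follow the construction of the trees below. *)
Fixpoint min_strings n (A : set (seq bool)) : seq (seq bool) :=
  if n is n'.+1 then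
    if `[< A [::] >] then [:: [::]]
    else map (cons false) (min_strings n' [set s | A (false :: s)]) ++
         map (cons true) (min_strings n' [set s | A (true :: s)])
  else [::].

Lemma min_strings_antichain n A s : antichain A -> A s -> size s < n ->
  List.In s (min_strings n A).
Proof.
elim: n A s => // n IH A s Aa As sn /=.
case: asboolP => [A0|NA0].
  left; apply: contrapT => /(Aa _ _ A0 As); by rewrite prefix0s.
case: s As sn => [//|b s] As sn.
rewrite In_cat !In_map.
have Ab b' : antichain [set s | A (b' :: s)].
  move=> u v Au Av uv; have := Aa _ _ Au Av; rewrite prefix_cons eqxx.
  by apply=> -[].
by case: b As sn => As sn; [right|left]; exists s => //; apply: IH.
Qed.

Lemma min_strings_set0 n : min_strings n set0 = [::].
Proof.
elim: n => //= n; case: asboolP => // _.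
by rewrite (_ : [set s | set0 (false :: s)] = set0) // => ->.
Qed.

Lemma min_strings_set1 n s : size s < n -> min_strings n [set s] = [:: s].
Proof.
elim: n s => // n IH [|b s] /= sn; case: asboolP => // _.
have E b' : [set x | [set b :: s] (b' :: x)] = if b' == b then [set s] else set0.
  apply/seteqP; split=> x /=.
    by move=> [-> ->]; rewrite eqxx.
  by case: eqP => [->|] // ->.
have E1 := E false; have E2 := E true.
rewrite E1 E2; by case: b {E E1 E2} => /=; rewrite min_strings_set0 IH.
Qed.

End Trees.

(** * The tree of an invariant type and a generic coheir *)

Section Brooms.
Variables (L : language) (K : Type) (U : structure L).
Hypothesis natK : small K [set: nat].
Hypothesis Usat : saturated K U.
Variable M : set U.
Hypothesis sM : small K M.
Variables (Y : Type) (p : set (formula L (Y + U))).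
Hypothesis pglob : global_type p.
Hypothesis pinv : invariant_over M p.
Hypothesis cY : countable [set: Y].
Variable m0 : U.
Hypothesis Mm0 : M m0.
Variables (X : Type) (Phi : (X + Y -> U) -> Prop).
Hypothesis dPhi : dfn M Phi.

Let T := Y -> U.
Let sY : small K [set: Y] := small_countable natK cY.

(** Lists of all lengths become tuples of the same length, so that their types
    over [M] can be compared; [m0] pads them. *)
Definition arr (l : seq T) : nat * Y -> U :=
  fun z => nth (fun=> m0) l z.1 z.2.

Definition jointly_sat (l : seq T) := exists x, forall v, List.In v l ->
  Phi (jn x v).

Lemma dfn_jointly_sat k : exists2 P : (nat * Y -> U) -> Prop,
  dfn M P & forall l, size l = k -> (jointly_sat l <-> P (arr l)).
Proof.
exists (fun e => exists x, forall i, List.In i (iota 0 k) ->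
  Phi (jn x (fun y => jn x e (inr (i, y))))).
  apply: (@dfn_ex _ _ _ X _ (fun e => forall i, List.In i (iota 0 k) ->
    Phi (jn (e \o inl) (fun y => e (inr (i, y)))))).
  apply: dfn_forall_seq => i _.
  pose g (v : X + Y) : X + nat * Y :=
    match v with inl x => inl x | inr y => inr (i, y) end.
  apply: dfn_ext (dfn_comp g dPhi) => e.
  by rewrite (_ : e \o g = jn (e \o inl) (fun y => e (inr (i, y)))) //;
    apply/funext => -[].
move=> l lk; split=> -[x H]; exists x.
  by move=> i /In_mem; rewrite mem_iota /= add0n => ilt;
    apply: (iffLR (In_nth _ _ _) H); rewrite lk.
apply/(In_nth (fun=> m0) l (fun v => Phi (jn x v))) => i ilt.
by apply: H; apply/In_mem; rewrite mem_iota /= add0n -lk.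
Qed.

(** An array assigns to each string a sequence of [Y]-tuples. *)
Definition node := (seq bool * (nat * Y))%type.

Definition block_sat N (e : node -> U) (x : X -> U) eta :=
  forall i, List.In i (iota 0 N) -> Phi (jn x (fun y => e (eta, (i, y)))).

(** The sequence [cs] is a Morley sequence of [p] over [M] and [vs]: the handles
    of a broom with bristles [vs]. *)
Fixpoint morley_below (vs cs : seq T) : Prop :=
  if cs is c :: cs' then realizes_over M p (arr vs) c /\ morley_below (c :: vs) cs' else True.

(** The same over a tuple of any length, such as a whole tree. *)
Fixpoint morley_over (cs : seq T) Z (e : Z -> U) : Prop :=
  if cs is c :: cs' then realizes_over M p e c /\ morley_over cs' (jn c e) else True.

Lemma arr_cons : exists g : nat * Y -> Y + nat * Y,
  forall c l, arr (c :: l) = jn c (arr l) \o g.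
Proof.
exists (fun z => if z.1 is i.+1 then inr (i, z.2) else inl z.2) => c l.
by apply/funext => -[[|i] y].
Qed.

Lemma morley_over_below cs Z (e : Z -> U) vs (g : nat * Y -> Z + U) :
  (forall i u, g i = inr u -> M u) -> arr vs = (fun i => env e (g i)) ->
  morley_over cs e -> morley_below vs cs.
Proof.
elim: cs Z e vs g => //= c cs IH Z e vs g gM E [ec ecs]; split.
  by rewrite E; exact: realizes_over_subst.
pose g' (z : nat * Y) : (Y + Z) + U := if z.1 is i.+1 then
  match g (i, z.2) with inl j => inl (inr j) | inr u =>
    inr u end else inl (inl z.2).
apply: (IH _ (jn c e) _ g') => //.
  move=> [[|i] y] u //; rewrite /g' /=; case E' : (g (i, y)) => [//|u'] [<-].
  exact: gM E'.
apply/funext => -[[|i] y] //=; rewrite /g' /=.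
have := congr1 (fun f => f (i, y)) E; rewrite /arr /= => ->.
by case: (g (i, y)).
Qed.

Lemma morley_over_ex j Z (e : Z -> U) : small K [set: Z] ->
  exists2 cs, size cs = j & morley_over cs e.
Proof.
elim: j Z e => [|j IH] Z e sZ; first by exists [::].
have [c ec] := realizes_over_ex natK Usat sM pglob sY e sZ.
have [|cs csj csP] := IH _ (jn c e); first exact: small_sum.
by exists (c :: cs) => //=; rewrite csj.
Qed.

Lemma morley_below_tp cs cs' vs vs' : size cs = size cs' ->
  tp (arr vs) M = tp (arr vs') M -> morley_below vs cs -> morley_below vs' cs' ->
  tp (arr (catrev cs vs)) M = tp (arr (catrev cs' vs')) M.
Proof.
elim: cs cs' vs vs' => [|c cs IH] [|c' cs'] vs vs' //= [Es] E [vc H] [vc' H'].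
apply: IH => //; have [g gE] := arr_cons; rewrite !gE.
by apply: tp_comp; exact: (realizes_over_tp pglob pinv E vc vc').
Qed.

Lemma size_catrev (cs vs : seq T) : size (catrev cs vs) = size cs + size vs.
Proof. by rewrite catrevE size_cat size_rev. Qed.

Lemma jointly_sat_tp l l' : size l = size l' -> tp (arr l) M = tp (arr l') M ->
  jointly_sat l -> jointly_sat l'.
Proof.
move=> E Et; have [P dP PE] := dfn_jointly_sat (size l); rewrite PE // PE //.
by move/(iffLR (tp_iff Et dP)).
Qed.

(** Consistency of the broom with [j] handles and bristles [vs]; by invariance
    of [p] it depends only on the type of [vs] over [M]. *)
Definition broom j (vs : seq T) :=
  exists cs, [/\ size cs = j, morley_below vs cs & jointly_sat (catrev cs vs)].

Lemma broom_iff cs vs : morley_below vs cs ->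
  broom (size cs) vs <-> jointly_sat (catrev cs vs).
Proof.
move=> H; split=> [[cs' [E H' sat']]|sat]; last by exists cs.
apply: jointly_sat_tp sat'; first by rewrite !size_catrev E.
exact: morley_below_tp.
Qed.

Lemma morley_below_ex j vs : exists2 cs, size cs = j & morley_below vs cs.
Proof.
have [|cs csj csP] := @morley_over_ex j _ (arr vs).
  by apply: small_countable => //; rewrite -setXTT; exact: countableX.
exists cs => //; apply: (morley_over_below (g := inl)) csP => //.
Qed.

Section Tree.
Variable Q : set_system T.
Hypothesis uQ : ultra Q.
Hypothesis QM : onM M Q.
Hypothesis Qgen : forall Z (S : set_system (Z -> U)) d, small K [set: Z] ->
  ultra S -> onM M S -> realizes_lim M S d ->
  exists R : set_system ((Y -> U) * (Z -> U)), [/\ ultra R,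
    forall A, Q A -> R [set q | A q.1], forall B, S B -> R [set q | B q.2] &
    forall P, dfn M P -> in_type p (fun x => P (jn x d)) ->
      R [set q | P (jn q.1 q.2)]].
Variable t : nat.

Definition realizes_pow k (l : seq T) :=
  size l = k /\ realizes_lim M (push arr (tpow Q k)) (arr l).

Lemma realizes_pow_tp k l l' : realizes_pow k l -> realizes_pow k l' ->
  tp (arr l) M = tp (arr l') M.
Proof.
move=> [_ Hl] [_ Hl']; apply: realizes_lim_tp Hl Hl'.
by apply: ultra_push; exact: ultra_tpow.
Qed.

Lemma realizes_pow_behead k l : realizes_pow k.+1 l ->
  realizes_pow k (behead l).
Proof.
case: l => [[]//|v l] [/= [Es] H]; split=> // P dP HP.
apply: (H (fun e => P (fun z => e (z.1.+1, z.2)))).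
  exact: (dfn_comp (fun z => (z.1.+1, z.2)) dP).
exact: (ultraT uQ).
Qed.

(** The block at a node is a root [w] followed by [t] tuples [V]. *)
Definition block (e : node -> U) (eta : seq bool) : seq T :=
  mkseq (fun i y => e (eta, (i, y))) t.+1.

Lemma nth_block e eta i y : nth (fun=> m0) (block e eta) i y =
  if i < t.+1 then e (eta, (i, y)) else m0.
Proof.
by case: ltnP => it; [rewrite nth_mkseq|rewrite nth_default // size_mkseq].
Qed.

(** A new root under two trees, given together by [a]. *)
Definition join (w : T) (a : node + node -> U) (V : seq T) : node -> U :=
  fun z => match z.1 with
  | [::] => nth (fun=> m0) (w :: V) z.2.1 z.2.2
  | false :: eta => a (inl (eta, z.2))
  | true :: eta => a (inr (eta, z.2))
  end.

Lemma block_join0 w a V : size V = t -> block (join w a V) [::] = w :: V.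
Proof.
move=> Vt; apply: (@eq_from_nth _ (fun=> m0));
  first by rewrite size_mkseq /= Vt.
by move=> i; rewrite size_mkseq => ilt; rewrite nth_mkseq.
Qed.

(** The coheir [E] describes trees of height [n] in which the blocks along an
    antichain form a Morley sequence of [Q], and the root of a block realizes
    [p] over the sequence [V] of each block above it. *)
Definition tree_type n (E : set_system (node -> U)) := [/\ ultra E, onM M E,
  forall A P, tpow Q (size (min_strings n A) * t.+1) P ->
    E [set e | P (flatten (map (block e) (min_strings n A)))] &
  forall e, realizes_lim M E e -> forall eta nu, prefix eta nu -> eta <> nu ->
    size nu < n -> realizes_over M p (arr (behead (block e nu))) (head (fun=> m0) (block e eta))].

Lemma small_node : small K [set: node].
Proof.
by apply: small_countable => //; rewrite -!setXTT; do 2! apply: countableX =>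
  //.
Qed.

(** The ultrafilter of the trees of height [n + 1] is built from two independent
    trees of height [n], given by [S]: the genericity of [Q] provides the root
    [w], and the sequence [V] is chosen independent from everything else. *)
Lemma tree_ex n : exists E, tree_type n E.
Proof.
elim: n => [|n [E [uE EM E1 E2]]].
  exists [set A | A (fun=> m0)]; split=> //; first exact: ultra_principal.
pose S := push (fun q : (node -> U) * (node -> U) => jn q.1 q.2) (tensor E E).
have uS : ultra S by apply/ultra_push/ultra_tensor.
have SM : onM M S.
  apply: (push_tensor uE uE EM EM) => x y Mx My [z|z]; [exact: Mx|exact: My].
have sZ : small K [set: node + node] by apply: small_sum => //;
  exact: small_node.
have [d dS] := realizes_lim_ex natK Usat sM sZ uS.
have [R [uR R1 R2 R3]] := Qgen sZ uS SM dS.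
have uQt := ultra_tpow uQ t.
pose E' := push (fun q : (T * (node + node -> U)) * seq T =>
  join q.1.1 q.1.2 q.2)
  (tensor R (tpow Q t)).
have uE' : ultra E' by apply/ultra_push/ultra_tensor.
have E'S P : S P -> E' [set e | P (jn (fun z => e (false :: z.1, z.2))
                                       (fun z => e (true :: z.1, z.2)))].
  move=> SP; apply: (push_tensor uR uQt (R2 _ SP) (tpow_size uQ t)) =>
    -[w a] V /= Pa _.
  suff -> : jn (fun z => join w a V (false :: z.1, z.2))
     (fun z => join w a V (true :: z.1, z.2)) = a by [].
  by apply/funext => -[[eta z]|[eta z]].
exists E'; split=> //.
- have QtM := tpow_all uQ t QM.
  apply: (push_tensor uR uQt
    (ultraI uR (R1 _ QM) (R2 _ SM)) (ultraI uQt (tpow_size uQ t) QtM)).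
  move=> [w a] V /= [Mw Ma] [Vt VM] [[|[] eta] [i y]].
  + rewrite /join /=; case: i => [|i] /=; first exact: Mw.
    have [ilt|ige] := ltnP i (size V); last by rewrite nth_default.
    by apply: (iffLR (In_nth (fun=> m0) V (fun v => forall z, M (v z)))).
  + exact: Ma.
  + exact: Ma.
- move=> A P /=; case: asboolP => A0.
    rewrite mul1n => /= HP.
    have HR := R1 _ HP.
    apply: (ultraS uR _ HR) => -[w a] /= HV.
    apply: (ultraS uQt _ (ultraI uQt HV (tpow_size uQ t))) => V [HP' Vt] /=.
    by rewrite -[X in P X]/(block (join w a V) [::] ++ [::]) block_join0 // cats0.
  rewrite size_cat !size_map mulnDl => /(tpow_cat uQ) HP.
  have HE : E [set x | E [set y | P
      (flatten (map (block x) (min_strings n [set s | A (false :: s)])) ++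
       flatten (map (block y) (min_strings n [set s | A (true :: s)])))]].
    apply: (E1 [set s | A (false :: s)] [set l | E [set y | P (l ++
       flatten (map (block y) (min_strings n [set s | A (true :: s)])))]]).
    apply: (ultraS (ultra_tpow uQ _) _ HP) => l HP'.
    exact: (E1 [set s | A (true :: s)] [set l' | P (l ++ l')]).
  have /E'S : S [set a : node + node -> U | P
    (flatten (map (block (a \o inl)) (min_strings n [set s | A (false :: s)])) ++
     flatten (map (block (a \o inr)) (min_strings n [set s | A (true :: s)])))] by exact: HE.
  apply: (ultraS uE') => e.
  by rewrite /= map_cat flatten_cat -!map_comp.
- move=> e eE'.
  pose a : node + node -> U := jn (fun z => e (false :: z.1, z.2))
                                  (fun z => e (true :: z.1, z.2)).
  have aE b s : block e (b :: s) = block (if b then a \o inr else a \o inl) s.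
    by case: b; apply: eq_mkseq.
  have Sa : realizes_lim M S a.
    move=> P dP /E'S; apply: (eE' (fun e => P (jn (fun z =>
      e (false :: z.1, z.2))
                                  (fun z => e (true :: z.1, z.2))))).
    pose g (v : node + node) : node := match v with
      | inl z => (false :: z.1, z.2) | inr z => (true :: z.1, z.2) end.
    apply: dfn_ext (dfn_comp g dP) => e'.
    suff -> : e' \o g = jn (fun z => e' (false :: z.1, z.2))
                           (fun z => e' (true :: z.1, z.2)) by [].
    by apply/funext => -[].
  move=> [|b eta] [|b' nu] //.
    move=> _ _ _.
    have ga : realizes_over M p a (head (fun=> m0) (block e [::])).
      move=> P dP hP.
      have hd := in_type_inv pglob pinv dP (realizes_lim_tp uS Sa dS) hP.
      pose g (v : Y + (node + node)) : node := match v with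
        | inl y => ([::], (0, y)) | inr (inl z) => (false :: z.1, z.2)
        | inr (inr z) => (true :: z.1, z.2) end.
      have gE e' : e' \o g = jn (fun y => e' ([::], (0, y)))
          (jn (fun z => e' (false :: z.1, z.2)) (fun z =>
            e' (true :: z.1, z.2))).
        by apply/funext => -[y|[z|z]].
      suff : P (e \o g) by rewrite gE.
      apply: (eE' (fun e' => P (e' \o g))); first exact: dfn_comp.
      apply: (push_tensor uR uQt (R3 _ dP hd) (tpow_size uQ t)) =>
        -[w a'] V /= H _.
      rewrite [_ \o g](_ : _ = jn w a') //.
      by apply/funext => -[y|[[? ?]|[? ?]]].
    have nuE i y : arr (behead (block e (b' :: nu))) (i, y) = env a
        (if i < t then inl (if b' then inr (nu, (i.+1, y)) else inl (nu, (i.+1, y)))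
         else inr m0).
      rewrite /arr nth_behead nth_block ltnS.
      by case: (i < t) => //; case: b'.
    have := realizes_over_subst (g := fun z => if z.1 < t then
      inl (if b' then inr (nu, (z.1.+1, z.2)) else inl (nu, (z.1.+1, z.2)))
      else inr m0) _ ga.
    rewrite (_ : arr _ = fun z => env a (if z.1 < t then
      inl (if b' then inr (nu, (z.1.+1, z.2)) else inl (nu, (z.1.+1, z.2)))
      else inr m0)); last by apply/funext => -[i y]; rewrite nuE.
    by apply=> -[i y] u /=; case: ifP => // _ [<-].
  rewrite prefix_cons => /andP[/eqP <- pre] ne sz; rewrite !aE.
  have eb : realizes_lim M E (if b then a \o inr else a \o inl).
    move=> P dP EP; case: b {pre ne sz}.
      apply: (Sa (fun e => P (e \o inr))); first exact: dfn_comp.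
      exact: (tensor_snd uE EP).
    apply: (Sa (fun e => P (e \o inl))); first exact: dfn_comp.
    exact: (tensor_fst uE EP uE).
  by apply: E2 eb _ _ pre _ sz => E0; apply: ne; rewrite E0.
Qed.

Lemma arr_flat s : exists2 g : nat * Y -> node + U,
  (forall i u, g i = inr u -> M u) &
  forall e, arr (flatten (map (block e) s)) = fun i => env e (g i).
Proof.
elim: s => [|eta s [g gM gE]].
  exists (fun=> inr m0); first by move=> i u [<-].
  by move=> e; apply/funext => -[i y]; rewrite /arr nth_nil.
exists (fun z => if z.1 < t.+1 then inl (eta, z) else g (z.1 - t.+1, z.2)).
  by move=> [i y] u /=; case: ifP => // _; exact: gM.
move=> e; apply/funext => -[i y].
have H := congr1 (fun f => f (i - t.+1, y)) (gE e).
transitivity (nth (fun=> m0) (block e eta ++ flatten (map (block e) s)) i y);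
  first by [].
rewrite nth_cat size_mkseq; case: (ltnP i t.+1) => it;
  first by rewrite nth_block /= it.
exact: H.
Qed.

Lemma flat_realizes_pow n E e A : tree_type n E -> realizes_lim M E e ->
  realizes_pow (size (min_strings n A) * t.+1) (flatten (map (block e) (min_strings n A))).
Proof.
move=> [uE EM E1 E2] Ee; split.
  elim: (min_strings n A) => [|eta s IH] //.
  rewrite (_ : flatten _ = block e eta ++ flatten (map (block e) s)) //.
  by rewrite size_cat IH size_mkseq [size (_ :: _)]/= mulSn.
move=> P dP HP; have [g gM gE] := arr_flat (min_strings n A).
rewrite gE; apply: (Ee (fun e => P (fun i => env e (g i)))).
  exact: dfn_subst.
have := E1 A [set l | P (arr l)] HP; apply: (ultraS uE) => e' /=.
by rewrite gE.
Qed.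

Lemma block_realizes_pow n E e nu : tree_type n E -> realizes_lim M E e ->
  size nu < n ->
  realizes_pow t.+1 (block e nu).
Proof.
move=> tE Ee nun; have := flat_realizes_pow [set nu] tE Ee.
by rewrite min_strings_set1 // mul1n /= cats0.
Qed.

Variable j : nat.
Hypothesis broomP : forall k vs, realizes_pow k vs -> broom j vs.
Hypothesis broomN : forall vs, realizes_pow t vs -> ~ broom j.+1 vs.

Definition atp_upto n (e : node -> U) :=
  (forall A, antichain A ->
     exists x, forall eta, A eta -> size eta < n -> block_sat (t.+1 + j) e x eta) /\
  (forall eta nu, prefix eta nu -> eta <> nu -> size nu < n ->
     ~ exists x, block_sat (t.+1 + j) e x eta /\ block_sat (t.+1 + j) e x nu).

(** Below the tree there are [j] more realizations [cs] of [p], repeated in all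
    the blocks.  An antichain of blocks with [cs] is a broom with [j] handles.
    For comparable blocks the lower root is one more handle below the sequence
    [V] of the upper block. *)
Lemma atp_upto_ex n : exists e, atp_upto n e.
Proof.
have [E tE] := tree_ex n; have [uE EM E1 E2] := tE.
have [e Ee] := realizes_lim_ex natK Usat sM small_node uE.
have [cs csj ecs] := morley_over_ex j e small_node.
pose e' (z : node) :=
  if z.2.1 < t.+1 then e z else nth (fun=> m0) cs (z.2.1 - t.+1) z.2.2.
have e'lt eta i : i < t.+1 ->
    (fun y => e' (eta, (i, y))) = nth (fun=> m0) (block e eta) i.
  by move=> it; apply/funext => y; rewrite nth_block /e' /= it.
have e'ge eta i : t.+1 <= i ->
    (fun y => e' (eta, (i, y))) = nth (fun=> m0) cs (i - t.+1).
  by move=> it; apply/funext => y; rewrite /e' /= ltnNge it.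
exists e'; split=> [A Aa|eta nu pre ne nun [x [xeta xnu]]].
  have [g gM gE] := arr_flat (min_strings n A).
  have csE := morley_over_below gM (gE e) ecs.
  have := broomP (flat_realizes_pow A tE Ee); rewrite -{1}csj =>
    /(broom_iff csE)[x xP].
  exists x => eta Aeta etan i /In_mem; rewrite mem_iota leq0n add0n andTb =>
    ilt.
  case: (ltnP i t.+1) => it.
    rewrite e'lt //; apply: xP; apply/In_catrev; right; apply/In_flatten.
    exists (block e eta); first by apply/In_map; exists eta => //;
      exact: min_strings_antichain.
    rewrite nth_mkseq //; apply/In_map; exists i => //.
    by apply/In_mem; rewrite mem_iota.
  rewrite e'ge //; apply: xP; apply/In_catrev; left.
  apply: (iffLR (In_nth (fun=> m0) cs (fun v => List.In v cs))) => //.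
  by rewrite csj ltn_subLR.
have etan : size eta < n by apply: leq_ltn_trans nun; exact: size_prefix.
have xP i : i < t.+1 + j -> List.In i (iota 0 (t.+1 + j)).
  by move=> ilt; apply/In_mem; rewrite mem_iota.
pose w := head (fun=> m0) (block e eta); pose V := behead (block e nu).
have VQ : realizes_pow t V by apply: realizes_pow_behead;
  exact: block_realizes_pow tE Ee nun.
have Vw : realizes_over M p (arr V) w by exact: E2.
apply: (broomN VQ); exists (w :: cs); split=> /=; first by rewrite csj.
  split=> //; apply: (morley_over_below (g := fun z => if z.1 is i.+1 then
      if i < t then inl (nu, (i.+1, z.2)) else inr m0
      else inl (eta, (0, z.2)))) ecs.
    by move=> [[|i] y] u //=; case: ifP => // _ [<-].
  apply/funext => -[[|i] y]; rewrite /arr //= nth_behead nth_block ltnS.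
  by case: (i < t).
exists x => v /In_catrev[vcs|/=[<-|vV]].
- move: v vcs; apply/(In_nth (fun=> m0) cs (fun v => Phi (jn x v))) => i ilt.
  have := xeta (t.+1 + i); rewrite e'ge ?leq_addr // addKn; apply.
  by apply: xP; rewrite ltn_add2l -csj.
- by have := xeta 0 (xP 0 isT); rewrite e'lt.
- move: v vV; apply/(In_nth (fun=> m0) V (fun v => Phi (jn x v))) => i.
  rewrite size_behead size_mkseq /= => ilt; rewrite nth_behead.
  have := xnu i.+1; rewrite e'lt //; apply.
  by apply: xP; rewrite addSn ltnS (leq_trans ilt) // leq_addr.
Qed.

Lemma dfn_block_sat eta :
  dfn M (fun e : X + node -> U =>
    block_sat (t.+1 + j) (e \o inr) (e \o inl) eta).
Proof.
apply: dfn_forall_seq => i _.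
pose g (v : X + Y) : X + node :=
  match v with inl x => inl x | inr y => inr (eta, (i, y)) end.
apply: dfn_ext (dfn_comp g dPhi) => e.
by rewrite (_ : e \o g = jn (e \o inl) (fun y => (e \o inr) (eta, (i, y)))) //;
  apply/funext => -[].
Qed.

Lemma atp_array : exists e : node -> U,
  (forall s : seq (seq bool), antichain [set eta | List.In eta s] ->
    exists x, forall eta, List.In eta s -> block_sat (t.+1 + j) e x eta) /\
  (forall eta nu, prefix eta nu -> eta <> nu ->
    ~ exists x, block_sat (t.+1 + j) e x eta /\ block_sat (t.+1 + j) e x nu).
Proof.
pose S : set ((node -> U) -> Prop) := [set P |
  (exists2 s, antichain [set eta | List.In eta s] &
     P = fun e => exists x, forall eta, List.In eta s -> block_sat (t.+1 + j) e x eta) \/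
  (exists eta nu, [/\ prefix eta nu, eta <> nu &
     P = fun e => ~ exists x, block_sat (t.+1 + j) e x eta /\ block_sat (t.+1 + j) e x nu])].
have [P [[s sa ->]|[eta [nu [pre ne ->]]]]|s sS|e eS] :=
    realize_dfn natK Usat (S := S) sM small_node.
- apply: (@dfn_ex _ _ _ X _ (fun e => forall eta, List.In eta s ->
    block_sat (t.+1 + j) (e \o inr) (e \o inl) eta)).
  by apply: dfn_forall_seq => eta _; exact: dfn_block_sat.
- apply/dfn_not/(@dfn_ex _ _ _ X _ (fun e =>
    block_sat (t.+1 + j) (e \o inr) (e \o inl) eta /\ block_sat (t.+1 + j) (e \o inr) (e \o inl) nu)).
  by apply: dfn_and; exact: dfn_block_sat.
- have [n nP] : exists n, forall m e, n <= m -> atp_upto m e ->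
      forall P, List.In P s -> P e.
    elim: s sS => [|P s IH] sS; first by exists 0.
    have [|n nP] := IH; first by move=> P0 P0s; apply: sS; right.
    have [n' n'P] : exists n', forall m e, n' <= m -> atp_upto m e -> P e.
      have [[s' s'a ->]|[eta [nu [pre ne ->]]]] := sS P (or_introl erefl).
        have [n' n'P] : exists n', forall eta, List.In eta s' -> size eta < n'.
          elim: s' {s'a} => [|eta s' [n' n'P]]; first by exists 0.
          exists (maxn (size eta).+1 n') => eta' [<-|/n'P H].
            by rewrite leq_max leqnn.
          by rewrite leq_max H orbT.
        exists n' => m e nm [/(_ _ s'a)[x xP] _]; exists x => eta etas.
        by apply: xP => //; apply: leq_trans nm; exact: n'P.
      by exists (size nu).+1 => m e nm [_]; apply.
    exists (maxn n n') => m e; rewrite geq_max => /andP[nm n'm] H P0 [<-|P0s].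
      exact: n'P H.
    exact: nP H _ P0s.
  have [e eP] := atp_upto_ex n; exists e; exact: nP eP.
exists e; split=> [s sa|eta nu pre ne].
  by apply: (eS (fun e =>
    exists x, forall eta, List.In eta s -> block_sat (t.+1 + j) e x eta));
      left; exists s.
apply: (eS (fun e =>
  ~ exists x, block_sat (t.+1 + j) e x eta /\ block_sat (t.+1 + j) e x nu)).
by right; exists eta, nu.
Qed.

End Tree.

End Brooms.

(** * Kim-dividing along a coheir *)

Section ArrayATP.
Variables (L : language) (U : structure L) (M : set U).

(** Only finitely many coordinates of the array and parameters from [M] occur in
    the conjunction over a block; they become the variables [y] of a formula
    without parameters. *)
Lemma array_has_ATP n m (Phi : ('I_n + 'I_m -> U) -> Prop) N
    (e : seq bool * (nat * 'I_m) -> U) : dfn M Phi ->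
  (forall s : seq (seq bool), antichain [set eta | List.In eta s] ->
    exists x, forall eta, List.In eta s -> block_sat Phi N e x eta) ->
  (forall eta nu, prefix eta nu -> eta <> nu ->
    ~ exists x, block_sat Phi N e x eta /\ block_sat Phi N e x nu) ->
  exists n' m' (phi : formula L ('I_n' + 'I_m')), has_ATP U phi.
Proof.
have [u0] := carrier_ne U.
move=> [th [_ thP]] Hanti Hcomp.
pose W := ((nat * 'I_m) + U)%type.
pose r i (v : ('I_n + 'I_m) + U) : 'I_n + W := match v with
  | inl (inl k) => inl k | inl (inr y) => inr (inl (i, y)) | inr u =>
    inr (inr u) end.
pose P (f : 'I_n + W -> U) :=
  forall i, List.In i (iota 0 N) -> sat (f \o r i) th.
have dP : dfn set0 P.
  apply: dfn_forall_seq => i _; exists (rename (inl \o r i) th); split.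
    by move=> u H; have [] := occurs_rename H.
  by move=> f; rewrite sat_rename.
have [m' [h [P' [_ [t' [t'0 t'P]] PP']]]] := dfn_fin dP.
pose r' (v : ('I_n + 'I_m') + U) : 'I_n + 'I_m'.+1 := match v with
  | inl (inl k) => inl k | inl (inr i) => inr (lift ord0 i) | inr u =>
    inr ord0 end.
pose wt eta (w : W) := match w with inl z => e (eta, z) | inr u => u end.
pose a eta (i : 'I_m'.+1) :=
  if unlift ord0 i is Some k then wt eta (h k) else u0.
exists n, m'.+1, (rename r' t').
have satE x eta : sat (env x) (inst (rename (plug inl) (rename r' t')) (a eta)) <->
    block_sat Phi N e x eta.
  have -> : block_sat Phi N e x eta <-> P (jn x (wt eta)).
    by split=> H i /H; rewrite thP; congr (sat _ th); apply/funext =>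
      -[[k|y]|u].
  rewrite PP' t'P !sat_rename; apply: sat_occurs => -[[k|i]|u] //=.
    by rewrite /a liftK.
  by move=> /t'0.
exists a; split.
- move=> A Aa F /finite_list[s sP] FA.
  have [etas etasA etasP] : exists2 etas : seq (seq bool),
      (forall eta, List.In eta etas -> A eta) &
      forall t, List.In t s -> exists2 eta, List.In eta etas &
        t = inst (rename (plug inl) (rename r' t')) (a eta).
    have {sP FA} : forall t, List.In t s ->
        [set inst (rename (plug inl) (rename r' t')) (a eta) | eta in A] t.
      by move=> t /sP/FA.
    elim: s => [|t s IH] sA; first by exists [::].
    have [eta Aeta tE] := sA t (or_introl erefl).
    have [t1 t1s|etas etasA etasP] := IH; first by apply: sA; right.
    exists (eta :: etas); first by move=> eta' [<-|/etasA].
    move=> t1 [<-|/etasP[eta' eta's ->]]; first by exists eta; [left|].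
    by exists eta' => //; right.
  have [|x xP] := Hanti etas.
    by move=> eta nu /etasA Aeta /etasA Anu; exact: Aa.
  by exists x => t /sP/etasP[eta etain ->]; apply/satE; exact: xP.
- move=> eta nu pre ne H; apply: (Hcomp eta nu pre ne).
  have [||x xP] := H [set inst (rename (plug inl) (rename r' t')) (a eta);
                          inst (rename (plug inl) (rename r' t')) (a nu)].
  - exact: finite_set2.
  - by [].
  by exists x; split; apply/satE; apply: xP; [left|right].
Qed.

End ArrayATP.

Section Generated.
Variables (L : language) (U : structure L) (M : set U).
Variables (Y : Type) (p : set (formula L (Y + U))).
Hypothesis pglob : global_type p.

Lemma in_type_formula P t : in_type p P ->
  (forall e, P e <-> sat (env e) t) -> p t.
Proof.
move=> [t' pt' Pt'] Pt; case: pglob => _ /(_ t)[//|pn].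
have [|x xs] := in_type_seq pglob (s := [:: t'; fNot t]);
  first by move=> ? [<-|[<-|]].
have : sat (env x) (fNot t) by apply: xs; right; left.
by case; apply/Pt/Pt'; apply: xs; left.
Qed.

(** The parameters that [generated] allows at the stage [i]. *)
Definition stage (s : nat -> Y -> U) i :=
  M `|` [set u | exists2 j, j < i & range (s j) u].

Lemma generated_in_type (s : nat -> Y -> U) i P : generated M p s ->
  dfn (stage s i) P -> in_type p P -> P (s i).
Proof.
move=> gs [t [tB tP]] hP; apply/tP; apply: (gs i); split=> //.
exact: in_type_formula hP tP.
Qed.

Lemma generated_realizes_over (s : nat -> Y -> U) i Z (z : Z -> U) :
  generated M p s ->
  (forall j, stage s i (z j)) -> realizes_over M p z (s i).
Proof.
move=> gs zB P dP hP; apply: (generated_in_type (P := fun x =>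
  P (jn x z)) gs) hP.
by apply: dfn_fix dP => // u Mu; left.
Qed.

End Generated.

Section KimCoheir.
Variables (L : language) (K : Type) (U : structure L).
Hypothesis natK : small K [set: nat].
Hypothesis Usat : saturated K U.
Hypothesis Unatp : NATP U.
Variable M : set U.
Hypothesis sM : small K M.
Hypothesis Mel : elementary_submodel M.

(** With [G j] for the consistency of all brooms with [j] handles: if [Phi] were
    consistent along [Q], then [G 0] would hold, whereas [G k] fails because of
    [s]; at a [j] where [G j] holds and [G j.+1] fails, [atp_array] yields ATP. *)
Lemma coheir_kim_divides n m (p : set (formula L ('I_m + U)))
    (Phi : ('I_n + 'I_m -> U) -> Prop) (s : nat -> 'I_m -> U) k :
  global_type p -> invariant_over M p -> dfn M Phi -> generated M p s ->
  ~ (exists x, forall i, i < k -> Phi (jn x (s i))) ->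
  exists Q : set_system ('I_m -> U), [/\ ultra Q, onM M Q,
    forall P, dfn M P -> in_type p P -> Q P &
    exists t, ~ tpow Q t [set l | jointly_sat Phi l]].
Proof.
move=> pglob pinv dPhi gs Nk.
have [m0 Mm0] := elem_ex Mel.
have [Q [uQ QM Qp Qgen]] := generic_ex natK Usat sM Mel pglob pinv.
exists Q; split=> //; apply: contrapT => /forallNP Nt.
have {}Nt t : tpow Q t [set l | jointly_sat Phi l] by apply: contrapT;
  exact: Nt.
have cY : countable [set: 'I_m] by exact: finite_set_countable.
pose G j := forall k vs, realizes_pow M m0 Q k vs -> broom M p m0 Phi j vs.
have G0 : G 0.
  move=> k0 vs [vk Hvs]; exists [::]; split=> //=.
  have [P dP PE] := dfn_jointly_sat m0 dPhi k0; apply/(PE _ vk); apply: Hvs =>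
    //.
  apply: (ultraS (ultra_tpow uQ k0) _ (ultraI (ultra_tpow uQ k0) (Nt k0) (tpow_size uQ k0))).
  by move=> l [sl /PE lk]; apply/lk.
have NGk : ~ G k.
  move=> /(_ 0 [::]) H; apply: Nk.
  have gen_s l i : morley_below M p m0 (rev (mkseq s i)) [seq s j | j <- iota i l].
    elim: l i => //= l IH i; split; last first.
      by have := IH i.+1; rewrite mkseqS rev_rcons.
    apply: (generated_realizes_over pglob gs) => -[j y]; rewrite /arr /=.
    have [jlt|jge] := ltnP j (size (rev (mkseq s i))); last first.
      by rewrite nth_default //; left.
    right; move: jlt; rewrite size_rev size_mkseq => jlt.
    rewrite nth_rev ?size_mkseq // nth_mkseq;
      last by rewrite ltn_subrL (leq_ltn_trans _ jlt).
    exists (i - j.+1); last by exists y.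
    by rewrite ltn_subrL (leq_ltn_trans _ jlt).
  have R0 : realizes_pow M m0 Q 0 [::] by split.
  have gk := gen_s k 0.
  have := H R0; rewrite -{1}(size_iota 0 k) -(size_map s).
  move=> /(broom_iff pglob pinv dPhi gk)[x xP]; exists x => i ik; apply: xP.
  apply/In_catrev; left; apply/In_map; exists i => //; apply/In_mem.
  by rewrite mem_iota.
have [j [Gj NGj]] : exists j, G j /\ ~ G j.+1.
  apply: contrapT => /forallNP H; apply: NGk.
  elim: {gs Nk} k => // j Gj; apply: contrapT => NGj; exact: (H j).
have /existsNP[t /existsNP[V /not_implyP[VQ NV]]] := NGj.
have NV' V' : realizes_pow M m0 Q t V' -> ~ broom M p m0 Phi j.+1 V'.
  move=> V'Q [cs [csj csV' cssat]]; apply: NV.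
  have [cs' cs'j cs'V] := morley_below_ex natK Usat sM pglob cY m0 j.+1 V.
  exists cs'; split=> //; apply: (jointly_sat_tp (m0 := m0) dPhi _ _ cssat).
    by rewrite !size_catrev csj cs'j; case: VQ V'Q => -> _ [-> _].
  apply: (morley_below_tp pglob pinv) => //; first by rewrite csj.
  exact: realizes_pow_tp V'Q VQ.
have [e [e1 e2]] := atp_array natK Usat sM pglob pinv cY Mm0 dPhi uQ QM Qgen Gj NV'.
have [n' [m' [phi Hphi]]] := array_has_ATP dPhi e1 e2.
exact: Unatp Hphi.
Qed.

End KimCoheir.

(** * Types and sequences given by ultrafilters *)

Section UltraTypes.
Variables (L : language) (U : structure L).

Lemma tp_in_type M Y (p : set (formula L (Y + U))) (b : Y -> U) P :
  tp b M `<=` p -> dfn M P -> P b -> in_type p P.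
Proof. by move=> bp [t [tM tP]] /tP Pb; exists t => //; apply: bp. Qed.

Definition utype Z (Q : set_system (Z -> U)) : set (formula L (Z + U)) :=
  [set t | Q [set e | sat (env e) t]].

Lemma utype_seq Z (Q : set_system (Z -> U)) F : ultra Q -> finite_set F ->
  F `<=` utype Q -> Q [set e | realizes e F].
Proof.
move=> uQ /finite_list[s sP] FQ.
have : Q [set e | forall t, List.In t s -> sat (env e) t].
  by apply: (ultra_seq uQ (P := fun t => [set e | sat (env e) t])) => t /sP/FQ.
by apply: (ultraS uQ) => e es t /sP/es.
Qed.

Lemma utype_global Z (Q : set_system (Z -> U)) : ultra Q ->
  global_type (utype Q).
Proof.
move=> uQ; split=> [F fF FQ|t].
  by have /(ultra_ex uQ) := utype_seq uQ fF FQ.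
by case: uQ => _ /(_ [set e | sat (env e) t]).
Qed.

Lemma utype_coheir M Z (Q : set_system (Z -> U)) : ultra Q -> onM M Q ->
  coheir_over M (utype Q).
Proof.
move=> uQ QM F fF FQ.
have [e [eM eF]] := ultra_ex uQ (ultraI uQ QM (utype_seq uQ fF FQ)).
by exists e.
Qed.

Lemma in_type_utype Z (Q : set_system (Z -> U)) B P : ultra Q -> dfn B P ->
  Q P ->
  in_type (utype Q) P.
Proof.
move=> uQ [t [_ tP]] QP; exists t => //.
by apply: (ultraS uQ _ QP) => e /tP.
Qed.

Lemma inst_jn X Y (phi : formula L (X + (Y + U))) x b :
  sat (env x) (inst phi b) <->
  sat (fun v => match v with inl i => x i | inr (inl j) =>
    b j | inr (inr u) => u end) phi.
Proof.
rewrite sat_rename (_ : env x \o plug (env b) = (fun v => match v with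
  inl i => x i | inr (inl j) => b j | inr (inr u) => u end)) //.
by apply/funext => -[i|[j|u]].
Qed.

Definition fml_pred X Y (phi : formula L (X + (Y + U))) (e : X + Y -> U) :=
  sat (fun v => match v with inl i => e (inl i) | inr (inl j) => e (inr j)
                           | inr (inr u) => u end) phi.

Lemma fml_predE X Y (phi : formula L (X + (Y + U))) x b :
  sat (env x) (inst phi b) <-> fml_pred phi (jn x b).
Proof. exact: inst_jn. Qed.

Lemma dfn_fml_pred M X Y (phi : formula L (X + (Y + U))) : fml2_over M phi ->
  dfn M (fml_pred phi).
Proof.
move=> phiM.
pose r (v : X + (Y + U)) : (X + Y) + U := match v with inl i => inl (inl i)
  | inr (inl j) => inl (inr j) | inr (inr u) => inr u end.
exists (rename r phi); split.
  move=> u H; have [[i|[j|u']] vt] := occurs_rename H => //= -[->].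
  exact: phiM.
move=> e; rewrite sat_rename /fml_pred.
rewrite (_ : env e \o r = fun v => match v with inl i => e (inl i)
  | inr (inl j) => e (inr j) | inr (inr u) => u end) //.
by apply/funext => -[i|[j|u]].
Qed.

Lemma fml_pred_ex M X Y (Phi : (X + Y -> U) -> Prop) : dfn M Phi ->
  exists2 phi : formula L (X + (Y + U)), fml2_over M phi &
    forall x b, sat (env x) (inst phi b) <-> Phi (jn x b).
Proof.
move=> [t [tM tP]].
pose r (v : (X + Y) + U) : X + (Y + U) := match v with inl (inl i) => inl i
  | inl (inr j) => inr (inl j) | inr u => inr (inr u) end.
exists (rename r t).
  move=> u H; have [[[i|j]|u'] vt] := occurs_rename H => //= -[->]; exact: tM.
move=> x b; rewrite tP !sat_rename.
rewrite (_ : (env x \o plug (env b)) \o r = env (jn x b)) //.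
by apply/funext => -[[i|j]|u].
Qed.

Lemma coheir_invariant M Z (p : set (formula L (Z + U))) :
  global_type p -> coheir_over M p -> invariant_over M p.
Proof.
move=> pglob pcoh n phi b b' phiM E.
suff H b1 b2 : tp b1 M = tp b2 M -> p (inst phi b1) -> p (inst phi b2).
  by split; [exact: H|exact: (H _ _ (esym E))].
move=> {}E p1; have [//|p2] := pglob.2 (inst phi b2).
have [||m mM mF] := pcoh [set inst phi b1; fNot (inst phi b2)].
- exact: finite_set2.
- by move=> t [->|->].
have m1 : sat (env m) (inst phi b1) by apply: mF; left.
have m2 : sat (env m) (fNot (inst phi b2)) by apply: mF; right.
case: m2; apply/fml_predE; move/fml_predE: m1.
have dP : dfn M (fun c : 'I_n -> U => fml_pred phi (jn m c)).
  exact: dfn_fixl (dfn_fml_pred phiM).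
by move/(iffLR (tp_iff E dP)).
Qed.

End UltraTypes.

Section Sequences.
Variables (L : language) (K : Type) (U : structure L).
Hypothesis natK : small K [set: nat].
Hypothesis Usat : saturated K U.
Variable M : set U.
Hypothesis sM : small K M.

Lemma generated_ex Z (p : set (formula L (Z + U))) : small K [set: Z] ->
  global_type p -> exists s, generated M p s.
Proof.
move=> sZ pglob.
pose B (l : seq (Z -> U)) := M `|` [set u | exists2 v, List.In v l & range v u].
have sB l : small K (B l).
  elim: l => [|v l IH].
    by apply: small_le sM; apply: subset_card_le => u [//|[]].
  apply: (small_le (B := B l `|` range v)); last first.
    by apply: small_setU => //; exact: small_range.
  apply: subset_card_le => u [Mu|[v' [<-|v'l] vu]]; [by left; left|by right|].
  by left; right; exists v'.
have /choice[next nextP] : forall l, exists v : Z -> U, realizes v (restr p (B l)).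
  move=> l; apply: (realize_type natK Usat (sB l) sZ); first by move=> t [].
  by move=> F fF Fp; apply: pglob.1 => // t /Fp[].
pose l i := iter i (fun l => next l :: l) [::].
exists (fun i => next (l i)) => i t [pt tB]; apply: nextP; split=> // u /tB.
case=> [Mu|[j ji ju]]; [by left|right; exists (next (l j)) => //].
elim: i ji {tB} => // i IH; rewrite ltnS leq_eqVlt => /orP[/eqP ->|/IH H].
  by left.
by right.
Qed.

(** The last entry of the sequence realizes the type over the previous ones,
    hence the reversal. *)
Lemma generated_realizes_pow Z (Q : set_system (Z -> U)) m0 s k : M m0 ->
  ultra Q -> onM M Q -> generated M (utype Q) s ->
  realizes_pow M m0 Q k (rev (mkseq s k)).
Proof.
move=> Mm0 uQ QM gs; elim: k => [|k [Hs IH]].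
  by split.
split; first by rewrite size_rev size_mkseq.
move=> P dP HP; rewrite mkseqS rev_rcons.
have [g gE] := arr_cons Z m0.
rewrite gE.
have dP' := dfn_comp g dP.
apply: (generated_in_type (utype_global uQ)
  (P := fun v => P (jn v (arr m0 (rev (mkseq s k))) \o g)) gs).
  apply: (dfn_fix (P := fun e => P (e \o g))) dP' => [u Mu|[j z]];
    first by left.
  rewrite /arr /=.
  have [jlt|jge] := ltnP j (size (rev (mkseq s k))); last first.
    by rewrite nth_default //; left.
  right; move: jlt; rewrite size_rev size_mkseq => jlt.
  have kj : k - j.+1 < k by rewrite ltn_subrL (leq_ltn_trans _ jlt).
  by rewrite nth_rev ?size_mkseq // nth_mkseq //; exists (k - j.+1) => //;
    exists z.
apply: (@in_type_utype _ _ _ _ setT) => //.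
  apply: (dfn_fix (P := fun e => P (e \o g))) dP' => //.
apply: (ultraS uQ _ (ultraI uQ QM HP)) => v [Mv Hv].
rewrite /= in Mv Hv *.
pose g1 (i : nat * Z) : nat * Z + U := match g i with inl z =>
  inr (v z) | inr j => inl j end.
have g1E e : (fun i => env e (g1 i)) = jn v e \o g.
  by apply/funext => i; rewrite /g1 /=; case: (g i).
apply: (IH (fun e => P (jn v e \o g))).
  apply: (@dfn_ext _ _ _ _ (fun e => P (fun i => env e (g1 i)))).
    by move=> e; rewrite g1E.
  by apply: dfn_subst dP => i u; rewrite /g1; case: (g i) => // z [<-].
by apply: (ultraS (ultra_tpow uQ k) _ Hv) => l /=; rewrite gE.
Qed.

End Sequences.

(** * Kim-dividing and Kim-forking *)

Section Kim.
Variables (L : language) (K : Type) (U : structure L).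
Variable M : set U.

Definition incons X Y (Phi : (X + Y -> U) -> Prop) (s : nat -> Y -> U) k :=
  ~ exists x, forall i, i < k -> Phi (jn x (s i)).

Lemma incons_le X Y (Phi : (X + Y -> U) -> Prop) s k k' : k <= k' ->
  incons Phi s k -> incons Phi s k'.
Proof.
move=> kk' H [x xP]; apply: H; exists x => i ik; apply: xP;
  exact: leq_trans kk'.
Qed.

(** A finite inconsistent set of instances lies in an initial segment. *)
Lemma inconsP X Y (phi : formula L (X + (Y + U))) s :
  ~ consistent [set inst phi (s i) | i in setT] <->
  exists k, incons (fml_pred phi) s k.
Proof.
split=> [/existsNP[F /not_implyP[fF /not_implyP[FS NF]]]|[k Hk] C].
  have [l lP] := finite_list fF.
  have [k kP] : exists k, forall t, List.In t l -> exists2 i, i < k & t = inst phi (s i).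
    have : forall t, List.In t l -> exists i, t = inst phi (s i).
      by move=> t /lP/FS[i _ <-]; exists i.
    elim: (l) => [|t l' IH] H; first by exists 0.
    have [|k kP] := IH; first by move=> t' t'l; apply: H; right.
    have [i ti] := H t (or_introl erefl); exists (maxn i.+1 k) =>
      t' [<-|/kP[j jk ->]].
      by exists i => //; rewrite leq_max leqnn.
    by exists j => //; rewrite leq_max jk orbT.
  exists k => -[x xP]; apply: NF; exists x => t /lP/kP[i ik ->].
  by apply/fml_predE; exact: xP.
have [||x xP] := C [set inst phi (s i) | i in `I_k].
- by apply: finite_image; exact: finite_II.
- by move=> t [i _ <-]; exists i.
by apply: Hk; exists x => i ik; apply/fml_predE; apply: xP; exists i.
Qed.

(** Kim-dividing for definable predicates, which hides the formula. *)
Definition kdiv X Y (Phi : (X + Y -> U) -> Prop) (b : Y -> U) :=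
  exists2 s, invariant_morley M b s & exists k, incons Phi s k.

Lemma kim_dividesE X Y (phi : formula L (X + (Y + U))) b :
  kim_divides M phi b <-> fml2_over M phi /\ kdiv (fml_pred phi) b.
Proof.
by split=> -[phiM [s sb /inconsP H]]; split=> //; exists s.
Qed.

Lemma kdiv_tp X Y (Phi : (X + Y -> U) -> Prop) b b' : tp b M = tp b' M ->
  kdiv Phi b -> kdiv Phi b'.
Proof. by move=> E [s [p [p1 p2 p3 p4]] H]; exists s => //; exists p;
  rewrite -E. Qed.

Lemma incons_finl X Y n (h : 'I_n -> X) (Phi : (X + Y -> U) -> Prop)
    (Phi' : ('I_n + Y -> U) -> Prop) s k : injective h ->
  (forall x y, Phi (jn x y) <-> Phi' (jn (x \o h) y)) ->
  incons Phi s k <-> incons Phi' s k.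
Proof.
move=> hI E; split=> H [x xP]; apply: H; last first.
  by exists (x \o h) => i /xP/E.
have [u0] := carrier_ne U.
have /choice[x' x'P] : forall v, exists u, forall i, v = h i -> u = x i.
  move=> v; have [[i ->]|N] := pselect (exists i, v = h i).
    by exists (x i) => j /hI ->.
  by exists u0 => i iv; case: N; exists i.
exists x' => i /xP H; apply/E; suff -> : x' \o h = x by [].
by apply/funext => j /=; exact: x'P.
Qed.

(** Witnesses are tested on formulas in finitely many variables [x]; this covers
    a tuple [x] of any length, as only finitely many entries occur. *)
Lemma kim_witness_incons X Y (Phi : (X + Y -> U) -> Prop) b s : dfn M Phi ->
  kim_witness M b s -> kdiv Phi b -> exists k, incons Phi s k.
Proof.
move=> dPhi [_ _ H] [s' s'b [k' Hk']].
have [n [h [Phi' [hI dPhi' E]]]] := dfn_finl dPhi.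
have [phi phiM phiE] := fml_pred_ex dPhi'.
have E' x y : Phi' (jn x y) <-> fml_pred phi (jn x y) by rewrite -fml_predE phiE.
have inE s0 k : incons Phi s0 k <-> incons (fml_pred phi) s0 k.
  rewrite (incons_finl _ _ hI E).
  by split=> N [x xP]; apply: N; exists x => i /xP/E'.
have /H/inconsP[k Hk] : kim_divides M phi b.
  by apply/kim_dividesE; split=> //; exists s' => //; exists k'; exact/inE.
by exists k; exact/inE.
Qed.

Lemma morley_comp Z Y (g : Y -> Z) (c : Z -> U) s : invariant_morley M c s ->
  invariant_morley M (c \o g) (fun i => s i \o g).
Proof.
move=> [p [pglob cp pinv gs]].
pose p' := [set t : formula L (Y + U) | in_type p (fun e =>
  sat (env (e \o g)) t)].
have dT (t : formula L (Y + U)) B : fml_over B t ->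
    dfn B (fun e : Z -> U => sat (env (e \o g)) t).
  move=> tB; exact: (dfn_comp g (dfn_sat tB)).
exists p'; split.
- split=> [F /finite_list[l lP] Fp'|t].
    have [|e eP] := in_type_seqs pglob (s := [seq (fun e =>
      sat (env (e \o g)) t) | t <- l]).
      by move=> P /In_map[t tl ->]; apply: Fp'; exact/lP.
    exists (e \o g) => t /lP tl.
    by apply: (eP (fun e => sat (env (e \o g)) t)); apply/In_map; exists t.
  exact: (in_type_dec pglob (dT t setT _)).
- by move=> t [tM tc]; apply: (tp_in_type cp (dT _ _ tM)).
- move=> n phi b b' phiM E.
  pose g' (v : Y + 'I_n) : Z + 'I_n := match v with inl y =>
    inl (g y) | inr i => inr i end.
  have dP : dfn M (fun e : Z + 'I_n -> U => fml_pred phi (e \o g')).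
    exact: dfn_comp (dfn_fml_pred phiM).
  have PE b0 : p' (inst phi b0) <->
      in_type p (fun e => fml_pred phi (jn e b0 \o g')).
    rewrite /p' /mkset.
    suff -> : (fun e : Z -> U => sat (env (e \o g)) (inst phi b0)) =
       (fun e => fml_pred phi (jn e b0 \o g')) by [].
    apply/funext => e; apply/propext; rewrite fml_predE.
    by rewrite (_ : jn e b0 \o g' = jn (e \o g) b0) //; apply/funext => -[].
  by rewrite !PE; split; apply: (in_type_inv pglob pinv dP).
- move=> i t [pt tB].
  apply: (generated_in_type pglob gs (P := fun e => sat (env (e \o g)) t)) pt.
  apply: dT => u /tB[Mu|[j ji [y _ yu]]]; [by left|right; exists j => //].
  by exists (g y).
Qed.

Lemma morley_tp Z (c : Z -> U) s i : invariant_morley M c s ->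
  tp (s i) M = tp c M.
Proof.
move=> [p [pglob cp pinv gs]]; apply/esym/tp_dfn => P dP Pc.
apply: (generated_in_type pglob gs); last exact: tp_in_type cp dP Pc.
by apply: dfn_sub dP => u Mu; left.
Qed.

Hypothesis natK : small K [set: nat].
Hypothesis Usat : saturated K U.
Hypothesis Unatp : NATP U.
Hypothesis sM : small K M.
Hypothesis Mel : elementary_submodel M.

(** An invariant type need not extend to one of a larger tuple, but a coheir
    does: the coheir given by [coheir_kim_divides] is extended to [c]. *)
Lemma kdiv_lift X m (Phi : (X + 'I_m -> U) -> Prop) Z (c : Z -> U) (g :
  'I_m -> Z) :
  small K [set: Z] -> dfn M Phi -> kdiv Phi (c \o g) ->
  kdiv (fun e => Phi (jn (e \o inl) (e \o inr \o g))) c.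
Proof.
move=> sZ dPhi [s [p [pglob cp pinv gs]] [k Hk]].
have [n [h [Phi' [hI dPhi' E]]]] := dfn_finl dPhi.
have {}Hk : incons Phi' s k by exact/(incons_finl _ _ hI E).
have [Q [uQ QM Qp [t Nt]]] :=
  coheir_kim_divides natK Usat Unatp sM Mel pglob pinv dPhi' gs Hk.
have [m0 Mm0] := elem_ex Mel.
(* the ultrafilter [Q] extends to the tuples of the length of [c] *)
pose D := [set C | exists A P, [/\ Q A, dfn M P, P c &
  C = [set e : Z -> U | [/\ forall z, M (e z), A (e \o g) & P e]]]].
have [|||Q' [uQ' Q'D]] := @ultra_base _ D.
- eexists; exists setT, (fun=> True); split=> //; first exact: (ultraT uQ).
  exact: dfn_true.
- move=> _ _ [A [P [QA dP Pc ->]]] [A' [P' [QA' dP' Pc' ->]]].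
  exists (A `&` A'), (fun e => P e /\ P' e); split=> //; first exact: ultraI.
    exact: dfn_and.
  by apply/seteqP; split=> e; [move=> [[? ? ?] [? ? ?]]|move=> [? [? ?] [? ?]]].
- move=> _ [A [P [QA dP Pc ->]]].
  (* almost every tuple [y] for [Q] extends to a tuple satisfying [P], and then to
     one in [M] since [M] is a model *)
  pose R (e : Z + 'I_m -> U) := P (e \o inl) /\
    forall i, List.In i (enum 'I_m) -> e (inl (g i)) = e (inr i).
  have dR : dfn M R.
    apply: dfn_and; first exact: dfn_comp.
    by apply: dfn_forall_seq => i _; exact: dfn_eq.
  have QR : Q [set y | exists e, R (jn e y)].
    apply: Qp; first exact: dfn_ex.
    by apply: (tp_in_type cp (dfn_ex dR)); exists c; split.
  have [y [[yM Ay] [e eR]]] := ultra_ex uQ (ultraI uQ (ultraI uQ QM QA) QR).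
  have [e' e'M [Pe' e'y]] := elem_jn Mel dR yM eR.
  exists e'; split=> //.
  suff -> : e' \o g = y by [].
  by apply/funext => i; apply: e'y; apply/In_mem; rewrite mem_enum.
have Q'M : onM M Q'.
  have : Q' [set e : Z -> U | [/\ forall z, M (e z), setT (e \o g) & True]].
    apply: Q'D; exists setT, (fun=> True); split=> //; first exact: (ultraT uQ).
    exact: dfn_true.
  by apply: (ultraS uQ') => e [].
have Q'Q A : Q A -> Q' [set e : Z -> U | A (e \o g)].
  move=> QA; have : Q' [set e : Z -> U | [/\ forall z, M (e z), A (e \o g) & True]].
    by apply: Q'D; exists A, (fun=> True); split=> //; exact: dfn_true.
  by apply: (ultraS uQ') => e [].
have cQ' : tp c M `<=` utype Q'.
  move=> t' [t'M t'c].
  have : Q' [set e : Z -> U | [/\ forall z, M (e z), setT (e \o g) & sat (env e) t']].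
    apply: Q'D; exists setT, (fun e => sat (env e) t'); split=> //;
      first exact: (ultraT uQ).
    exact: dfn_sat.
  by apply: (ultraS uQ') => e [].
have QTQ' j P : tpow Q j P -> tpow Q' j [set l : seq (Z -> U) | P [seq v \o g | v : Z -> U <- l]].
  elim: j P => //= j IH P /Q'Q; apply: (ultraS uQ') => e /IH; exact.
have [s' gs'] := generated_ex natK Usat sM sZ (utype_global uQ').
exists s'.
  exists (utype Q'); split=> //; first exact: utype_global.
  by apply: coheir_invariant; [exact: utype_global|exact: utype_coheir].
exists t.
pose Psi (e : 'I_n + Z -> U) := Phi' (jn (e \o inl) (e \o inr \o g)).
have dPsi : dfn M Psi.
  pose g' (v : 'I_n + 'I_m) : 'I_n + Z :=
    match v with inl x => inl x | inr y => inr (g y) end.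
  apply: dfn_ext (dfn_comp g' dPhi') => e; rewrite /Psi.
  by rewrite (_ : e \o g' = jn (e \o inl) (e \o inr \o g)) //; apply/funext =>
    -[].
have [P dP PE] := dfn_jointly_sat m0 dPsi t.
have [sz Ht] := generated_realizes_pow t Mm0 uQ' Q'M gs'.
have NP : ~ P (arr m0 (rev (mkseq s' t))).
  apply: (Ht (fun e => ~ P e)); first exact: dfn_not.
  have QN := ultraN (ultra_tpow uQ t) Nt.
  have := ultraI (ultra_tpow uQ' t) (QTQ' _ _ QN) (tpow_size uQ' t).
  apply: (ultraS (ultra_tpow uQ' t)) => l [Nl sl] /(PE _ sl)[x xP]; apply: Nl.
  exists x => v /In_map[e el ->]; exact: xP.
move=> [x xP]; apply: NP; apply/(PE _ sz); exists (x \o h) => v.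
have : forall i, i < t -> Psi (jn (x \o h) (s' i)) by move=> i /xP/E.
move=> H vin; have [i it ->] : exists2 i, i < t & v = s' i.
  move: v vin; apply/(In_nth (fun=> m0) _ (fun v =>
    exists2 i, i < t & v = s' i)) => i.
  rewrite size_rev size_mkseq => it; rewrite nth_rev ?size_mkseq // nth_mkseq.
    by exists (t - i.+1) => //; rewrite ltn_subrL (leq_ltn_trans _ it).
  by rewrite ltn_subrL (leq_ltn_trans _ it).
exact: H.
Qed.

End Kim.

Lemma mono_subseq N k (col : nat -> 'I_N) : exists (c : 'I_N) (f : 'I_k -> nat),
  {homo f : i j / (i < j)%N} /\ forall i, f i < (N * k).+1 /\ col (f i) = c.
Proof.
pose s c := [seq i <- iota 0 (N * k).+1 | col i == c].
have [c ck] : exists c, k <= size (s c).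
  apply: contrapT => /forallNP H.
  have : \sum_(c < N) size (s c) <= \sum_(c < N) k.
    by apply: leq_sum => c _; rewrite leqNgt; apply/negP => /ltnW; exact: H.
  rewrite sum_nat_const card_ord leqNgt => /negP; apply.
  suff -> : \sum_(c < N) size (s c) = (N * k).+1 by [].
  rewrite -[RHS](size_iota 0) /s.
  elim: (iota _ _) => [|i l IH] /=; first by rewrite big1.
  rewrite -IH (eq_bigr (fun c =>
    (col i == c) + size [seq j <- l | col j == c])).
    rewrite big_split /= (bigD1 (col i)) //= eqxx big1 ?addn0 ?add1n // => c.
    by rewrite eq_sym => /negbTE ->.
  by move=> c _; case: ifP.
have sc i : i < k -> nth 0 (s c) i \in s c.
  by move=> ik; apply: mem_nth; exact: leq_trans ck.
exists c, (fun i => nth 0 (s c) i); split=> [i j ij|i].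
  apply: (sorted_ltn_nth ltn_trans) => //; rewrite ?inE ?(leq_trans _ ck) //.
  exact: sorted_filter ltn_trans _ _ (iota_ltn_sorted _ _).
have := sc i (ltn_ord i); rewrite mem_filter mem_iota => /andP[/eqP -> /=].
by rewrite add0n.
Qed.

Section Forking.
Variables (L : language) (K : Type) (U : structure L).
Hypothesis natK : small K [set: nat].
Hypothesis Usat : saturated K U.
Hypothesis Unatp : NATP U.
Variable M : set U.
Hypothesis sM : small K M.
Hypothesis Mel : elementary_submodel M.

(** The parameters of a Kim-dividing formula, as a sequence indexed by [nat] so
    that several formulas can be treated uniformly. *)
Lemma kim_divides_fml_lift X (psi : formula L (X + U)) :
  kim_divides_fml M psi ->
  exists (b : nat -> U) (Psi : (X + nat -> U) -> Prop), [/\ dfn M Psi,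
    forall x, Psi (jn x b) <-> sat (env x) psi &
    forall Z (c : Z -> U) (g : nat -> Z), small K [set: Z] -> c \o g = b ->
      kdiv M (fun e => Psi (jn (e \o inl) (e \o inr \o g))) c].
Proof.
have [u0] := carrier_ne U.
move=> [m [phi [a [-> /kim_dividesE[phiM phia]]]]].
pose val' := (fun i : 'I_m => val i).
pose b (i : nat) : U := if insub i : option 'I_m is Some j then a j else u0.
exists b, (fun e => fml_pred phi (jn (e \o inl) (e \o inr \o val'))).
have aE : b \o val' = a by apply/funext => i; rewrite /b /= valK.
split.
- pose g' (v : X + 'I_m) : X + nat :=
    match v with inl x => inl x | inr y => inr (val y) end.
  apply: dfn_ext (dfn_comp g' (dfn_fml_pred phiM)) => e.
  by rewrite (_ : e \o g' = jn (e \o inl) (e \o inr \o val')) //;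
    apply/funext => -[].
- by move=> x; rewrite fml_predE -aE.
- move=> Z c g sZ cg.
  have := @kdiv_lift L K U M natK Usat Unatp sM Mel X m (fml_pred phi) Z c
    (g \o val') sZ (dfn_fml_pred phiM).
  by apply; rewrite -[c \o _]/((c \o g) \o val') cg aE.
Qed.

Hypothesis wit : forall (N : set U) (Y : Type) (c : Y -> U),
  small_model K N -> small K [set: Y] ->
  exists s : nat -> Y -> U, invariant_morley N c s /\ kim_witness N c s.

(** A witness for the tuple made of [a] and of all the parameters of the
    Kim-dividing formulas makes every disjunct inconsistent, hence the
    disjunction, by indiscernibility and the pigeonhole principle. *)
Lemma kim_forks_divides X Y (Phi : (X + Y -> U) -> Prop) (a : Y -> U) N
    (psi : 'I_N -> formula L (X + U)) : small K [set: Y] -> dfn M Phi ->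
  (forall j, kim_divides_fml M (psi j)) ->
  (forall x, Phi (jn x a) -> exists j, sat (env x) (psi j)) -> kdiv M Phi a.
Proof.
move=> sY dPhi psidiv Phipsi.
have /choice[b /choice[Psi H]] := fun j => kim_divides_fml_lift (psidiv j).
pose Z := (Y + 'I_N * nat)%type.
have sZ : small K [set: Z].
  apply: small_sum => //; apply: small_countable => //; exact: countableP.
pose c : Z -> U := jn a (fun z => b z.1 z.2).
pose g (j : 'I_N) i : Z := inr (j, i).
have [s [sc sw]] := wit c (conj sM Mel) sZ.
pose Psi' j (e : X + Z -> U) := Psi j (jn (e \o inl) (e \o inr \o g j)).
have dPsi' j : dfn M (Psi' j).
  have [dPsi _ _] := H j.
  pose g' (v : X + nat) : X + Z := match v with inl x => inl x | inr i =>
    inr (g j i) end.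
  apply: dfn_ext (dfn_comp g' dPsi) => e; rewrite /Psi'.
  by rewrite (_ : e \o g' = jn (e \o inl) (e \o inr \o g j)) //;
    apply/funext => -[].
have /choice[k kP] : forall j, exists k, incons (Psi' j) s k.
  move=> j; apply: (kim_witness_incons (dPsi' j) sw).
  by have [_ _] := H j; apply.
pose k' := \max_j k j.
have k'P j : incons (Psi' j) s k'.
  by apply: incons_le (kP j); exact: leq_bigmax.
(* by indiscernibility any increasing subsequence of length [k'] will do *)
have k'mono j (f : 'I_k' -> nat) : {homo f : i j / (i < j)%N} ->
    ~ exists x, forall i, Psi' j (jn x (s (f i))).
  move=> fh; have [sind _ _] := sw.
  have E := sind k' (fun i => val i) f (fun i j ij => ij) fh.
  pose R (e : 'I_k' * Z -> U) :=
    exists x : X -> U, forall i, List.In i (enum 'I_k') ->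
    Psi' j (jn x (fun z => e (i, z))).
  have dR : dfn M R.
    apply: (@dfn_ex _ _ _ X _ (fun e => forall i, List.In i (enum 'I_k') ->
      Psi' j (jn (e \o inl) (fun z => e (inr (i, z)))))).
    apply: dfn_forall_seq => i _.
    pose g' (v : X + Z) : X + 'I_k' * Z :=
      match v with inl x => inl x | inr z => inr (i, z) end.
    apply: dfn_ext (dfn_comp g' (dPsi' j)) => e.
    by rewrite (_ : e \o g' = jn (e \o inl) (fun z => e (inr (i, z)))) //;
      apply/funext => -[].
  move=> [x xP].
  have : R (fun v => s (f v.1) v.2) by exists x => i _; exact: xP.
  move=> /(iffRL (tp_iff E dR))[x' x'P]; apply: (k'P j); exists x' => i ik.
  by apply: (x'P (Ordinal ik)); apply/In_mem; rewrite mem_enum.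
exists (fun i => s i \o inl).
  exact: (morley_comp inl sc).
exists (N * k').+1 => -[x xP].
pose R (e : Z -> U) := forall x : X -> U, Phi (jn x (e \o inl)) ->
  ~ forall j, List.In j (enum 'I_N) -> ~ Psi' j (jn x e).
have dR : dfn M R.
  apply: (@dfn_all _ _ _ X _ (fun e => Phi (jn (e \o inl) (e \o inr \o inl)) ->
    ~ forall j, List.In j (enum 'I_N) -> ~ Psi' j (jn (e \o inl) (e \o inr)))).
  apply: dfn_imp.
    pose g' (v : X + Y) : X + Z :=
      match v with inl x => inl x | inr y => inr (inl y) end.
    apply: dfn_ext (dfn_comp g' dPhi) => e.
    by rewrite (_ : e \o g' = jn (e \o inl) (e \o inr \o inl)) //;
      apply/funext => -[].
  apply: dfn_not; apply: dfn_forall_seq => j _; apply: dfn_not.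
  apply: dfn_ext (dPsi' j) => e.
  by rewrite (_ : jn (e \o inl) (e \o inr) = e) //; apply/funext => -[].
have Rc : R c.
  move=> x' /Phipsi[j jx'] /(_ j); apply; first by apply/In_mem;
    rewrite mem_enum.
  by have [_ HPsi _] := H j; apply/HPsi.
have /choice[col colP] : forall i, exists j, i < (N * k').+1 -> Psi' j (jn x (s i)).
  move=> i; have [ik|ik] := boolP (i < (N * k').+1); last first.
    have [j _] : exists j : 'I_N, True.
      apply: contrapT => /forallNP NN.
      have := iffRL (tp_iff (morley_tp 0 sc) dR) Rc x (xP 0 (ltn0Sn _)).
      by apply=> j; case: (NN j).
    by exists j.
  have := iffRL (tp_iff (morley_tp i sc) dR) Rc x (xP i ik).
  move=> NN; apply: contrapT => /forallNP NE; apply: NN => j _ Pj.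
  exact: (NE j).
have [j [f [fh fP]]] := mono_subseq k' col.
apply: (k'mono j f fh); exists x => i.
by have [fi <-] := fP i; exact: colP.
Qed.

End Forking.

(** * Strict coheirs *)

Section Coheir.
Variables (L : language) (U : structure L) (M : set U).
Variables (X : Type) (p : set (formula L (X + U))).
Hypothesis pglob : global_type p.
Hypothesis pcoh : coheir_over M p.

Lemma coheir_seqs (s : seq ((X -> U) -> Prop)) :
  (forall P, List.In P s -> in_type p P) ->
  exists2 m : X -> U, (forall i, M (m i)) & forall P, List.In P s -> P m.
Proof.
move=> sp.
have [l [lp lP]] : exists l : seq (formula L (X + U)), (forall t, List.In t l -> p t) /\
    forall m, (forall t, List.In t l -> sat (env m) t) -> forall P, List.In P s -> P m.
  elim: s sp => [|P s IH] sp; first by exists [::].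
  have [|l [lp lP]] := IH; first by move=> Q Qs; apply: sp; right.
  have [t pt tP] := sp P (or_introl erefl).
  exists (t :: l); split=> [t' [<-|/lp]//|m H Q [<-|Qs]].
    by apply/tP; apply: H; left.
  by apply: lP Qs => t' t'l; apply: H; right.
have [||m mM mP] := pcoh (F := [set t | List.In t l]).
- elim: (l) => [|t l' IH]; first by apply: sub_finite_set (finite_set0 _) => t.
  have -> : [set t' | List.In t' (t :: l')] = [set t] `|` [set t' | List.In t' l'].
    by apply/seteqP; split=> t' [->|H]; by [left|right].
  by rewrite finite_setU; split=> //; exact: finite_set1.
- by move=> t /lp.
- by exists m => //; exact: lP.
Qed.

(** If [p] contained [Psi(c, x)], the sequence [I] could be replaced, from its
    last entry down, by tuples of [M] that satisfy [Psi(c, x)]: then [c] would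
    realize all the instances of [Psi] at once. *)
Lemma coheir_consistent n (Psi : ('I_n + X -> U) -> Prop) (c : 'I_n -> U) I k :
  dfn M Psi -> generated M p I -> in_type p (fun x =>
    Psi (jn c x)) -> ~ incons Psi I k.
Proof.
move=> dPsi gI hPsi Ik.
have H i : i <= k -> exists ms : seq (X -> U),
    (forall v, List.In v ms -> (forall z, M (v z)) /\ Psi (jn c v)) /\
    ~ exists x, (forall v, List.In v ms -> Psi (jn x v)) /\
                forall j, j < k - i -> Psi (jn x (I j)).
  elim: i => [|i IH] ik.
    exists [::]; split=> //; rewrite subn0 => -[x [_ xP]]; apply: Ik.
    by exists x.
  have [ms [msP Nms]] := IH (ltnW ik).
  pose j0 := k - i.+1.
  have j0E : k - i = j0.+1 by rewrite /j0 subnSK.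
  pose P (y : X -> U) := ~ exists x, (forall v, List.In v ms -> Psi (jn x v)) /\
    ((forall j, List.In j (iota 0 j0) -> Psi (jn x (I j))) /\ Psi (jn x y)).
  have dP : dfn (stage M I j0) P.
    apply: dfn_not.
    apply: (@dfn_ex _ _ _ 'I_n _ (fun e =>
      (forall v, List.In v ms -> Psi (jn (e \o inl) v)) /\
      ((forall j, List.In j (iota 0 j0) -> Psi (jn (e \o inl) (I j))) /\
       Psi (jn (e \o inl) (e \o inr))))).
    have dv B v : M `<=` B -> (forall z, B (v z)) ->
        dfn B (fun e : 'I_n + X -> U => Psi (jn (e \o inl) v)).
      move=> MB vB; exact: (dfn_comp inl (dfn_fix MB vB dPsi)).
    apply: dfn_and.
      apply: dfn_forall_seq => v vms; apply: dv => [u Mu|z]; first by left.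
      by left; have [] := msP v vms.
    apply: dfn_and.
      apply: dfn_forall_seq => j /In_mem; rewrite mem_iota => /andP[_ jj0].
      apply: dv => [u Mu|z]; first by left.
      by right; exists j => //; exists z.
    apply: dfn_ext (dfn_sub _ dPsi) => [e|u Mu]; last by left.
    by rewrite (_ : jn (e \o inl) (e \o inr) = e) //; apply/funext => -[].
  have PI : P (I j0).
    move=> [x [xms [xI xj]]]; apply: Nms; exists x; split=> // j.
    rewrite j0E ltnS leq_eqVlt => /orP[/eqP -> //|jj0].
    by apply: xI; apply/In_mem; rewrite mem_iota.
  have hP : in_type p P.
    have [//|hN] := in_type_dec pglob (dfn_sub (@subsetT _ _) dP).
    by have := generated_in_type pglob gI (dfn_not dP) hN.
  have [|m Mm mP] := coheir_seqs (s := [:: P; fun x => Psi (jn c x)]).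
    by move=> Q [<-|[<-|]].
  exists (m :: ms); split=> [v [<-|/msP//]|[x [xms xI]]].
    by split=> //; apply: (mP (fun x => Psi (jn c x))); right; left.
  apply: (mP P (or_introl erefl)); exists x; split.
    by move=> v vms; apply: xms; right.
  split; last by apply: xms; left.
  by move=> j /In_mem; rewrite mem_iota => /andP[_]; exact: xI.
have [ms [msP]] := H k (leqnn k); apply; exists c; split=> [v /msP[]//|j].
by rewrite subnn.
Qed.

End Coheir.

Theorem proposition4p7 (L : language) (T : set (formula L void)) (K : Type)
    (U : structure L) :
  complete_theory T ->
  monster T K U ->
  NATP U ->
  (forall (N : set U) (Y : Type) (c : Y -> U),
     small_model K N -> small K [set: Y] ->
     exists s : nat -> Y -> U, invariant_morley N c s /\ kim_witness N c s) ->
  forall (M : set U) (X : Type) (a : X -> U) (I : nat -> X -> U),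
    small_model K M -> small K [set: X] ->
    coheir_morley M a I -> I 0 = a ->
    kim_witness M a I ->
    strict_coheir_morley K M a I.
Proof.
move=> _ [_ [natK _ _] Usat _] Unatp wit M X a I [sM Mel] sX.
move=> [p [pglob ap pcoh gI]] I0 Iwit.
pose MI := M `|` [set u | exists j, range (I j) u].
(* [Bad chi]: in [q], the formula [chi] would make a type over [M] and a
   realization of [q] Kim-fork *)
pose Bad (chi : (X -> U) -> Prop) := exists n (Psi : ('I_n + X -> U) -> Prop) c,
  [/\ dfn M Psi, kdiv M Psi a & chi = fun x => Psi (jn c x)].
have NBad chi : Bad chi -> ~ in_type p chi.
  move=> [n [Psi [c [dPsi Psia ->]]]] hchi.
  have [k Ik] := kim_witness_incons dPsi Iwit Psia.
  exact: (coheir_consistent pglob pcoh dPsi gI hchi Ik).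
have dBad chi : Bad chi -> dfn setT chi.
  move=> [n [Psi [c [dPsi _ ->]]]]. by apply: dfn_fixl dPsi.
(* [q] has to contain the part of [p] over [M] and [I], so as to generate [I],
   and to avoid all bad formulas *)
pose D := [set C | exists theta s, [/\ dfn MI theta, in_type p theta,
  forall chi, List.In chi s -> Bad chi & C = [set e : X -> U |
   [/\ forall z, M (e z), theta e & forall chi, List.In chi s -> ~ chi e]]]].
have hT : in_type p (fun=> True).
  have [t pt] : exists t, p t.
    by case: pglob => _ /(_ fFalse)[] ?; eexists; eassumption.
  apply: (in_typeS pglob (P := fun e => sat (env e) t)) => //;
    first by exists t.
  exact: dfn_true.
have [|||q [uq qD]] := @ultra_base _ D.
- eexists; exists (fun=> True), [::]; split=> //; exact: dfn_true.
- move=> _ _ [th [s [dth hth sB ->]]] [th' [s' [dth' hth' sB' ->]]].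
  exists (fun e => th e /\ th' e), (s ++ s'); split.
  + exact: dfn_and.
  + by apply: (in_type_incl pglob hth hth') => //;
      exact: dfn_sub (@subsetT _ _) (dfn_and dth dth').
  + by move=> chi /In_cat[/sB|/sB'].
  + apply/seteqP; split=> e.
      by move=> [[? ? H] [? ? H']]; split=> // chi /In_cat[/H|/H'].
    by move=> [? [? ?] H]; split; split=> // chi chis; apply: H; apply/In_cat;
      [left|right].
- move=> _ [th [s [dth hth sB ->]]].
  have [|m Mm mP] := coheir_seqs pcoh (s := th :: [seq (fun x =>
    ~ chi x) | chi <- s]).
    move=> P [<-//|/In_map[chi /sB Bchi ->]].
    by have [/(NBad _ Bchi)|] := in_type_dec pglob (dBad _ Bchi).
  exists m; split=> //; first by apply: mP; left.
  move=> chi chis; apply: (mP (fun x => ~ chi x)); right; apply/In_map.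
  by exists chi.
have qp th : dfn MI th -> in_type p th -> q th.
  move=> dth hth; have : q [set e : X -> U | [/\ forall z, M (e z), th e &
      forall chi, List.In chi [::] -> ~ chi e]].
    by apply: qD; exists th, [::].
  by apply: (ultraS uq) => e [].
have qM : onM M q.
  have : q [set e : X -> U | [/\ forall z, M (e z), True &
      forall chi, List.In chi [::] -> ~ chi e]].
    by apply: qD; exists (fun=> True), [::]; split=> //; exact: dfn_true.
  by apply: (ultraS uq) => e [].
have qBad chi : Bad chi -> q [set e | ~ chi e].
  move=> Bchi; have : q [set e : X -> U | [/\ forall z, M (e z), True &
      forall chi', List.In chi' [:: chi] -> ~ chi' e]].
    apply: qD; exists (fun=> True), [:: chi]; split=> //; first exact: dfn_true.
    by move=> chi' [<-|].
  by apply: (ultraS uq) => e [_ _]; apply; left.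
have aq : tp a M `<=` utype q.
  move=> t tat; have [tM _] := tat.
  apply: (qp (fun e => sat (env e) t)).
    by apply: dfn_sub (dfn_sat tM) => u Mu; left.
  by exists t => //; exact: ap.
exists (utype q); split=> //.
- exact: utype_global.
- move=> C a' sC a'q.
  have a'P P : dfn (M `|` C) P -> q P -> P a'.
    move=> [t [tB tP]] qP; apply/tP; apply: a'q; split=> //.
    by apply: (ultraS uq _ qP) => e /tP.
  have qa' P : dfn (M `|` C) P -> P a' -> q P.
    move=> dP Pa'; apply: contrapT => /(ultraN uq) qN.
    exact: (a'P _ (dfn_not dP) qN).
  have a'tp : tp a M = tp a' M.
    apply/tp_dfn => P dP Pa; apply: a'P.
      by apply: dfn_sub dP => u Mu; left.
    move: dP Pa => [t [tM tP]] /tP ta.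
    have : tp a M t by [].
    by move/aq; apply: (ultraS uq) => e /tP.
  split.
    move=> F fF Fa'; apply: (utype_coheir uq qM fF) => t /Fa'[tB ta'].
    exact: (qa' _ (dfn_sat tB)).
  move=> [n [psi [psidiv /existsNP[F /not_implyP[fF /not_implyP[FS NF]]]]]].
  (* the part of [F] in the type defines a formula [Phi(y, a')] over [M] *)
  have [l lP] := finite_list fF.
  pose H (y : {u | C u} -> U) := forall t, List.In t l ->
    tp (@enum_set U C) (M `|` range a') t -> sat (env y) t.
  have dH : dfn (M `|` range a') H.
    apply: dfn_forall_seq => t _.
    have [tt|Nt] := pselect (tp (@enum_set U C) (M `|` range a') t).
      have [tB _] := tt.
      by apply: dfn_ext (dfn_sat tB) => e; split=> // H'; exact: H'.
    by apply: dfn_ext (@dfn_true _ U _ _) => e; split.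
  have HC : H (@enum_set U C) by move=> t _ [].
  have Hpsi y : H y -> exists j, sat (env y) (psi j).
    move=> Hy; apply/sat_bigor; apply: contrapT => N; apply: NF.
    by exists y => t Ft; have [/Hy|->] := FS _ Ft; [apply; exact/lP|].
  have [Phi dPhi HPhi] := dfn_split dH.
  have Phidiv : kdiv M Phi a'.
    apply: (kim_forks_divides natK Usat Unatp sM Mel wit sX dPhi psidiv) => y.
    by move/HPhi/Hpsi.
  have [k [h [Phi' [hI dPhi' PhiE]]]] := dfn_finl dPhi.
  have Phi'div : kdiv M Phi' a.
    apply: (kdiv_tp (esym a'tp)); case: Phidiv => s sa' [j sj]; exists s => //.
    by exists j; exact/(incons_finl _ _ hI PhiE).
  have BPhi : Bad (fun x => Phi' (jn (@enum_set U C \o h) x)).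
    by exists k, Phi', (@enum_set U C \o h).
  have NPhi := a'P _ _ (qBad _ BPhi).
  apply: NPhi; last by apply/PhiE/HPhi.
  apply/dfn_not/(dfn_fixl _ _ dPhi') => [u Mu|i]; first by left.
  by right; exact: svalP.
- move=> i t [qt tB].
  have dt : dfn (stage M I i) (fun e => sat (env e) t) by exact: dfn_sat.
  have dtMI : dfn MI (fun e => sat (env e) t).
    by apply: dfn_sub dt => u [Mu|[j _ ju]]; [left|right; exists j].
  have [ht|hN] := in_type_dec pglob (dfn_sub (@subsetT _ _) dt).
    exact: (generated_in_type pglob gI dt ht).
  have [e [qe Ne]] := ultra_ex uq (ultraI uq qt (qp _ (dfn_not dtMI) hN)).
  by case: Ne.
Qed.
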